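(* Let $\mathcal C$ be a strict braided monoidal category with equalizers and coequalizers. Let $H$ be an object of $\mathcal C$ equipped with a unital magma structure $(H,\eta_H,\mu_H)$ and a comonoid structure $(H,\varepsilon_H,\delta_H)$ satisfying conditions (a1), (a2) and (a3) of the context. Then the following assertions are equivalent: (i) $H$ is a weak Hopf quasigroup. (ii) The morphisms $f=q_{R}^{1}\circ \beta\circ j_{L}^{1}:H\times_{L}^{1} H\rightarrow H\times_{R}^{1} H$ and $g=q_{L}^{2}\circ \gamma\circ j_{R}^{2}:H\times_{R}^{2} H\rightarrow H\times_{L}^{2} H$ are isomorphisms, the morphism $j_{L}^{1}\circ f^{-1}\circ q_{R}^{1}:H\otimes H\to H\otimes H$ is almost left $H$-linear, and the morphism $j_{R}^{2}\circ g^{-1}\circ q_{L}^{2}:H\otimes H\to H\otimes H$ is almost right $H$-linear.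
   Context: $\mathcal C$ has tensor product $\otimes$, unit object $K$ and braiding $c_{M,N}:M\otimes N\to N\otimes M$. An object $M$ also denotes its identity morphism in tensor products, e.g. $M\otimes f=id_M\otimes f$. Since $\mathcal C$ has equalizers (and coequalizers), all idempotents split. A unital magma $(H,\eta_H,\mu_H)$ consists of morphisms $\eta_H:K\to H$, $\mu_H:H\otimes H\to H$ with $\mu_H\circ(H\otimes\eta_H)=id_H=\mu_H\circ(\eta_H\otimes H)$ (associativity is not required). A comonoid $(H,\varepsilon_H,\delta_H)$ is counital and coassociative. $\delta_{H\otimes H}=(H\otimes c_{H,H}\otimes H)\circ(\delta_H\otimes\delta_H)$. For $u,v:H\to H$ the convolution is $u\ast v=\mu_H\circ(u\otimes v)\circ\delta_H$. Conditions: (a1) $\delta_{H}\circ \mu_{H}=(\mu_{H}\otimes \mu_{H})\circ \delta_{H\otimes H}$. (a2) $\varepsilon_{H}\circ \mu_{H}\circ (\mu_{H}\otimes H)=\varepsilon_{H}\circ \mu_{H}\circ (H\otimes \mu_{H})= ((\varepsilon_{H}\circ \mu_{H})\otimes (\varepsilon_{H}\circ\mu_{H}))\circ (H\otimes \delta_{H}\otimes H)=((\varepsilon_{H}\circ \mu_{H})\otimes (\varepsilon_{H}\circ\mu_{H}))\circ (H\otimes (c_{H,H}^{-1}\circ\delta_{H})\otimes H)$. (a3) $(\delta_{H}\otimes H)\circ \delta_{H}\circ \eta_{H}=(H\otimes\mu_{H}\otimes H)\circ ((\delta_{H}\circ \eta_{H}) \otimes (\delta_{H}\circ\eta_{H}))=(H\otimes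 (\mu_{H}\circ c_{H,H}^{-1})\otimes H)\circ ((\delta_{H}\circ \eta_{H}) \otimes (\delta_{H}\circ \eta_{H}))$. Define $\Pi_{H}^{L}=((\varepsilon_{H}\circ\mu_{H})\otimes H)\circ (H\otimes c_{H,H})\circ ((\delta_{H}\circ \eta_{H})\otimes H)$ and $\Pi_{H}^{R}=(H\otimes(\varepsilon_{H}\circ \mu_{H}))\circ (c_{H,H}\otimes H)\circ (H\otimes (\delta_{H}\circ \eta_{H}))$. $H$ (unital magma and comonoid) is a weak Hopf quasigroup if (a1), (a2), (a3) hold and moreover (a4): there is a morphism $\lambda_H:H\to H$ (the antipode) such that (a4-1) $\Pi_{H}^{L}=id_{H}\ast \lambda_{H}$; (a4-2) $\Pi_{H}^{R}=\lambda_{H}\ast id_{H}$; (a4-3) $\lambda_{H}\ast \Pi_{H}^{L}=\Pi_{H}^{R}\ast \lambda_{H}= \lambda_{H}$; (a4-4) $\mu_H\circ (\lambda_H\otimes \mu_H)\circ (\delta_H\otimes H)=\mu_{H}\circ (\Pi_{H}^{R}\otimes H)$; (a4-5) $\mu_H\circ (H\otimes \mu_H)\circ (H\otimes \lambda_H\otimes H)\circ (\delta_H\otimes H)=\mu_{H}\circ (\Pi_{H}^{L}\otimes H)$; (a4-6) $\mu_H\circ(\mu_H\otimes \lambda_H)\circ (H\otimes \delta_H)=\mu_{H}\circ (H\otimes \Pi_{H}^{L})$; (a4-7) $\mu_H\circ (\mu_H\otimes H)\circ (H\otimes \lambda_H\otimes H)\circ (H\otimes \delta_H)=\mu_{H}\circ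 (H\otimes \Pi_{H}^{R})$. For $\sigma\in\{L,R\}$ define $\Omega_{\sigma}^{1}=(\mu_H\otimes H)\circ (H\otimes \Pi_{H}^{\sigma}\otimes H)\circ (H\otimes \delta_H)$ and $\Omega_{\sigma}^{2}=(H\otimes \mu_H)\circ (H\otimes \Pi_{H}^{\sigma}\otimes H)\circ (\delta_H\otimes H)$. Under (a1)-(a3) these are idempotent endomorphisms of $H\otimes H$; for $\alpha\in\{1,2\}$, $H\times_\sigma^\alpha H$ with $q_{\sigma}^{\alpha}:H\otimes H\to H\times_\sigma^\alpha H$, $j_{\sigma}^{\alpha}:H\times_\sigma^\alpha H\to H\otimes H$ denotes a splitting: $j_{\sigma}^{\alpha}\circ q_{\sigma}^{\alpha}=\Omega_{\sigma}^{\alpha}$, $q_{\sigma}^{\alpha}\circ j_{\sigma}^{\alpha}=id$. The right and left Galois morphisms are $\beta=(\mu_H\otimes H)\circ (H\otimes \delta_H)$ and $\gamma=(H\otimes \mu_H)\circ (\delta_H\otimes H)$. A morphism $\phi:H\otimes H\to H\otimes H$ is almost left $H$-linear if $\phi=(\mu_H\otimes H)\circ (H\otimes \phi)\circ (H\otimes \eta_H\otimes H)$, and almost right $H$-linear if $\phi=(H\otimes \mu_H)\circ (\phi\otimes H)\circ (H\otimes \eta_H\otimes H)$. *)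

(* Defs.v *)
Set Implicit Arguments.
Unset Strict Implicit.

(** * Categories with equalizers and coequalizers *)

Record category := Category {
  ob :> Type;
  hom : ob -> ob -> Type;
  idm : forall A, hom A A;
  comp : forall A B D, hom B D -> hom A B -> hom A D;
  comp_idl : forall A B (f : hom A B), comp (idm B) f = f;
  comp_idr : forall A B (f : hom A B), comp f (idm A) = f;
  comp_assoc : forall A B D E (h : hom D E) (g : hom B D) (f : hom A B),
    comp h (comp g f) = comp (comp h g) f
}.

Arguments hom {c} A B.
Arguments idm {c} A.
Arguments comp {c A B D} g f.

Definition is_equalizer (C : category) (A B E : C) (f g : hom A B)
    (e : hom E A) : Prop :=
  comp f e = comp g e /\
  forall (X : C) (h : hom X A), comp f h = comp g h ->
    exists! k : hom X E, comp e k = h.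

Definition is_coequalizer (C : category) (A B Q : C) (f g : hom A B)
    (p : hom B Q) : Prop :=
  comp p f = comp p g /\
  forall (X : C) (h : hom B X), comp h f = comp h g ->
    exists! k : hom Q X, comp k p = h.

Definition has_equalizers (C : category) : Prop :=
  forall (A B : C) (f g : hom A B),
    exists (E : C) (e : hom E A), is_equalizer f g e.

Definition has_coequalizers (C : category) : Prop :=
  forall (A B : C) (f g : hom A B),
    exists (Q : C) (p : hom B Q), is_coequalizer f g p.

Definition inverse_morphisms (C : category) (A B : C)
    (f : hom A B) (f' : hom B A) : Prop :=
  comp f' f = idm A /\ comp f f' = idm B.

(** * Equality of morphisms over propositionally equal objects *)

(* In a strict monoidal category the objects [(A ⊗ B) ⊗ D] and
   [A ⊗ (B ⊗ D)] are equal, but only propositionally so.  [f ≡ g] says that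
   [f] and [g] are the same morphism, sources and targets included, when their
   types are not convertible. *)
Record arrow (C : category) := Arrow {
  source : C;
  target : C;
  mor : hom source target
}.
Arguments Arrow {C source target} mor.

Notation "f ≡ g" := (Arrow f = Arrow g) (at level 70, no associativity).

Definition transport_hom (C : category) (A B A' B' : C) (f : hom A B)
    (eA : A = A') (eB : B = B') : hom A' B' :=
  eq_rect B (fun Y => hom A' Y) (eq_rect A (fun X => hom X B) f A' eA) B' eB.

Arguments transport_hom {C A B A' B'} & f eA eB.

(* Composition of [g] and [f] when the source of [g] and the target of [f] are
   equal but not convertible. *)
Definition compose (C : category) (A B B' D : C) (g : hom B' D) (f : hom A B)
    (e : B = B') : hom A D :=
  comp g (transport_hom f eq_refl e).

(** * Strict braided monoidal categories *)

Declare Scope ob_scope.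
Declare Scope mor_scope.
Delimit Scope ob_scope with ob.
Delimit Scope mor_scope with mor.

Record strict_monoidal_category := StrictMonoidalCategory {
  monoidal_cat :> category;
  unit_ob : monoidal_cat;
  tens : monoidal_cat -> monoidal_cat -> monoidal_cat;
  tensm : forall A B A' B' : monoidal_cat,
    hom A B -> hom A' B' -> hom (tens A A') (tens B B');
  tensm_id : forall A B, tensm (idm A) (idm B) = idm (tens A B);
  tensm_comp : forall (A B D A' B' D' : monoidal_cat)
    (g : hom B D) (f : hom A B) (g' : hom B' D') (f' : hom A' B'),
    tensm (comp g f) (comp g' f') = comp (tensm g g') (tensm f f');
  tens_assoc : forall A B D, tens (tens A B) D = tens A (tens B D);
  tens_unitl : forall A, tens unit_ob A = A;
  tens_unitr : forall A, tens A unit_ob = A;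
  tensm_assoc : forall (A B A' B' A'' B'' : monoidal_cat)
    (f : hom A B) (f' : hom A' B') (f'' : hom A'' B''),
    tensm (tensm f f') f'' ≡ tensm f (tensm f' f'');
  tensm_unitl : forall (A B : monoidal_cat) (f : hom A B),
    tensm (idm unit_ob) f ≡ f;
  tensm_unitr : forall (A B : monoidal_cat) (f : hom A B),
    tensm f (idm unit_ob) ≡ f
}.

Arguments unit_ob {s}.
Arguments tens {s} A B.
Arguments tensm {s A B A' B'} f g.

Notation "A ⊗ B" := (tens A%ob B%ob)
  (at level 40, left associativity) : ob_scope.
Notation "f ⊗ g" := (tensm f%mor g%mor)
  (at level 40, left associativity) : mor_scope.
Bind Scope mor_scope with hom.

(* Proves the equations between objects that hold by strictness. *)
Ltac strictness :=
  first [ exact eq_refl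
        | rewrite ?tens_unitl, ?tens_unitr, ?tens_assoc; exact eq_refl ].

(* Composition up to strict associativity and unitality of objects; it is
   [comp g f] up to conversion when the middle objects are convertible. *)
Notation "g ∘ f" := (compose g%mor f%mor ltac:(strictness))
  (at level 50, left associativity, only parsing) : mor_scope.
Notation "g ∘ f" := (compose g f _)
  (at level 50, left associativity, only printing) : mor_scope.

(* [f], seen as a morphism between objects strictly equal to its own. *)
Notation "⟨ f ⟩" := (transport_hom f%mor ltac:(strictness) ltac:(strictness))
  (at level 0, f at level 200, only parsing) : mor_scope.
Notation "⟨ f ⟩" := (transport_hom f _ _)
  (at level 0, f at level 200, only printing) : mor_scope.

Local Open Scope mor_scope.

Record strict_braided_monoidal_category := StrictBraidedMonoidalCategory {
  braided_cat :> strict_monoidal_category;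
  braid : forall A B : braided_cat, hom (A ⊗ B)%ob (B ⊗ A)%ob;
  braid_inv : forall A B : braided_cat, hom (B ⊗ A)%ob (A ⊗ B)%ob;
  braidK : forall A B, inverse_morphisms (braid A B) (braid_inv A B);
  braid_natural : forall (A A' B B' : braided_cat)
    (f : hom A A') (g : hom B B'),
    comp (braid A' B') (f ⊗ g) = comp (g ⊗ f) (braid A B);
  braid_tensr : forall A B D : braided_cat,
    braid A (B ⊗ D)%ob ≡ (idm B ⊗ braid A D) ∘ (braid A B ⊗ idm D);
  braid_tensl : forall A B D : braided_cat,
    braid (A ⊗ B)%ob D ≡ (braid A D ⊗ idm B) ∘ (idm A ⊗ braid B D)
}.

Arguments braid {s} A B.
Arguments braid_inv {s} A B.

(** * Unital magmas and comonoids *)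

Record unital_magma (C : strict_monoidal_category) (H : C) := UnitalMagma {
  eta : hom unit_ob H;
  mu : hom (H ⊗ H)%ob H;
  mu_etar : mu ∘ (idm H ⊗ eta) ≡ idm H;
  mu_etal : mu ∘ (eta ⊗ idm H) ≡ idm H
}.

Record comonoid (C : strict_monoidal_category) (H : C) := Comonoid {
  eps : hom H unit_ob;
  delta : hom H (H ⊗ H)%ob;
  delta_epsl : (eps ⊗ idm H) ∘ delta ≡ idm H;
  delta_epsr : (idm H ⊗ eps) ∘ delta ≡ idm H;
  delta_assoc : (delta ⊗ idm H) ∘ delta ≡ (idm H ⊗ delta) ∘ delta
}.

(** * Weak Hopf quasigroups *)

Section WeakHopfQuasigroup.

Variables (C : strict_braided_monoidal_category) (H : C).
Variables (M : unital_magma H) (D : comonoid H).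

Local Notation "'Id'" := (idm H).
Local Notation "'η'" := (eta M).
Local Notation "'μ'" := (mu M).
Local Notation "'ε'" := (eps D).
Local Notation "'δ'" := (delta D).
Local Notation "'c'" := (braid H H).
Local Notation "'c⁻¹'" := (braid_inv H H).

Definition delta_HH : hom (H ⊗ H)%ob ((H ⊗ H) ⊗ (H ⊗ H))%ob :=
  ⟨ (Id ⊗ c ⊗ Id) ∘ (δ ⊗ δ) ⟩.

Definition convolution (u v : hom H H) : hom H H := μ ∘ (u ⊗ v) ∘ δ.
Local Notation "u ∗ v" := (convolution u v) (at level 40).

Definition cond_a1 : Prop := δ ∘ μ = (μ ⊗ μ) ∘ delta_HH.

Definition cond_a2 : Prop :=
  ε ∘ μ ∘ (μ ⊗ Id) ≡ ε ∘ μ ∘ (Id ⊗ μ) /\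
  ε ∘ μ ∘ (Id ⊗ μ) ≡ ((ε ∘ μ) ⊗ (ε ∘ μ)) ∘ (Id ⊗ δ ⊗ Id) /\
  ((ε ∘ μ) ⊗ (ε ∘ μ)) ∘ (Id ⊗ δ ⊗ Id)
    ≡ ((ε ∘ μ) ⊗ (ε ∘ μ)) ∘ (Id ⊗ (c⁻¹ ∘ δ) ⊗ Id).

Definition cond_a3 : Prop :=
  (δ ⊗ Id) ∘ δ ∘ η ≡ (Id ⊗ μ ⊗ Id) ∘ ((δ ∘ η) ⊗ (δ ∘ η)) /\
  (Id ⊗ μ ⊗ Id) ∘ ((δ ∘ η) ⊗ (δ ∘ η))
    ≡ (Id ⊗ (μ ∘ c⁻¹) ⊗ Id) ∘ ((δ ∘ η) ⊗ (δ ∘ η)).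

Definition PiL : hom H H :=
  ⟨ ((ε ∘ μ) ⊗ Id) ∘ (Id ⊗ c) ∘ ((δ ∘ η) ⊗ Id) ⟩.

Definition PiR : hom H H :=
  ⟨ (Id ⊗ (ε ∘ μ)) ∘ (c ⊗ Id) ∘ (Id ⊗ (δ ∘ η)) ⟩.

Record is_antipode (lam : hom H H) : Prop := IsAntipode {
  a4_1 : PiL = Id ∗ lam;
  a4_2 : PiR = lam ∗ Id;
  a4_3l : lam ∗ PiL = lam;
  a4_3r : PiR ∗ lam = lam;
  a4_4 : μ ∘ (lam ⊗ μ) ∘ (δ ⊗ Id) = μ ∘ (PiR ⊗ Id);
  a4_5 : μ ∘ (Id ⊗ μ) ∘ (Id ⊗ lam ⊗ Id) ∘ (δ ⊗ Id) = μ ∘ (PiL ⊗ Id);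
  a4_6 : μ ∘ (μ ⊗ lam) ∘ (Id ⊗ δ) = μ ∘ (Id ⊗ PiL);
  a4_7 : μ ∘ (μ ⊗ Id) ∘ (Id ⊗ lam ⊗ Id) ∘ (Id ⊗ δ) = μ ∘ (Id ⊗ PiR)
}.

Definition weak_hopf_quasigroup : Prop :=
  cond_a1 /\ cond_a2 /\ cond_a3 /\ exists lam : hom H H, is_antipode lam.

Inductive side := L | R.

Definition Pi (s : side) : hom H H := match s with L => PiL | R => PiR end.

Definition Omega1 (s : side) : hom (H ⊗ H)%ob (H ⊗ H)%ob :=
  (μ ⊗ Id) ∘ (Id ⊗ Pi s ⊗ Id) ∘ (Id ⊗ δ).

Definition Omega2 (s : side) : hom (H ⊗ H)%ob (H ⊗ H)%ob :=
  (Id ⊗ μ) ∘ (Id ⊗ Pi s ⊗ Id) ∘ (δ ⊗ Id).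

Definition galois_right : hom (H ⊗ H)%ob (H ⊗ H)%ob := (μ ⊗ Id) ∘ (Id ⊗ δ).

Definition galois_left : hom (H ⊗ H)%ob (H ⊗ H)%ob := (Id ⊗ μ) ∘ (δ ⊗ Id).

Definition almost_left_linear (phi : hom (H ⊗ H)%ob (H ⊗ H)%ob) : Prop :=
  phi ≡ (μ ⊗ Id) ∘ (Id ⊗ phi) ∘ (Id ⊗ η ⊗ Id).

Definition almost_right_linear (phi : hom (H ⊗ H)%ob (H ⊗ H)%ob) : Prop :=
  phi ≡ (Id ⊗ μ) ∘ (phi ⊗ Id) ∘ (Id ⊗ η ⊗ Id).

End WeakHopfQuasigroup.

(** * Splittings of idempotents *)

Record splitting (C : category) (A : C) (Om : hom A A) := Splitting {
  split_ob : C;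
  split_q : hom A split_ob;
  split_j : hom split_ob A;
  split_jq : comp split_j split_q = Om;
  split_qj : comp split_q split_j = idm split_ob
}.

(* Main.v *)
From Stdlib Require Import ProofIrrelevance.
Require Import Defs.

(** Write [H ⊗ -] for the endofunctor [X ↦ H ⊗ X] of the category.  The
    structure of [H] turns it into an endofunctor with a unit, a multiplication,
    a counit, a comultiplication and a braiding, all natural in [X], and a
    morphism between tensor powers of [H] is determined by the natural
    transformation that it induces.  Iterated application of an endofunctor is
    associative by computation, so every string diagram in [H] becomes a
    composite of morphisms of the plain category, without any coherence.  The
    computations with diagrams are carried out in this form, for an arbitrary
    endofunctor with such a structure, called a weak bimonad.

    In Sweedler notation, with braidings suppressed, the conditions [cond_a1],
    [cond_a2] and [cond_a3] give [x ΠL(y) = ε(x₁ y) x₂] and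
    [ΠL(y) z = ε(ΠL(y) z₁) z₂] ([mult_PiL], [PiL_mult]).  Hence the comultiplication is linear over the
    image of [ΠL] on either side, and although the product is not associative,
    elements of that image do associate in the middle and on the left
    ([PiL_middle], [PiL_left]): expand both sides with [w = ε(w₁) w₂] and use
    the associativity of [ε (x y z)].  The same construction applied to [- ⊗ H],
    that is to the mirror image of the category, gives the corresponding
    statements on [ΠR], and the left Galois morphism is the mirror image of the
    right one.  Thus only the right Galois morphism [β (x ⊗ h) = x h₁ ⊗ h₂] needs
    to be studied.

    The associativity rules give [β Ω_L = β = Ω_R β], so that [β] always
    restricts to the images of the two idempotents, and an inverse of this
    restriction is the same thing as an endomorphism [φ] of [H ⊗ H] with
    [φ β = Ω_L], [β φ = Ω_R] and [φ Ω_R = φ = Ω_L φ].  If [λ] is an antipode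
    then [φ (x ⊗ h) = x λ(h₁) ⊗ h₂] has these properties
    ([antipode_galois_inverse]).  Conversely such a [φ] is colinear because [β]
    is; if it is moreover almost left linear, colinearity and linearity force
    [φ] to be given by that formula with [λ = (H ⊗ ε) φ (η ⊗ H)], and reading off
    the four equations yields all the axioms of an antipode in which [λ] acts on
    the right of another element ([galois_inverse_antipode]).  The left Galois
    morphism yields a [λ'] which satisfies the axioms where it acts on the left,
    and finally [λ = ΠR ∗ λ = (λ' ∗ H) ∗ λ = λ' ∗ ΠL = λ'] ([antipode_unique]). *)

Set Implicit Arguments.
Unset Strict Implicit.

Local Open Scope mor_scope.

Local Notation "g ∙ f" := (comp g f) (at level 41, right associativity).

(** * Weak bimonads *)

(** An endofunctor [T] that behaves like [H ⊗ -] for a unital magma and comonoid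
    [H] satisfying [cond_a1], [cond_a2] and [cond_a3].  In [T (T X)] the outer [T]
    is the left strand.
    The naturality of the braiding with respect to the structure of [H] consists
    of the fields from [bm_yang_baxter] to [bm_braid_counitr]. *)
Record weak_bimonad (C : category) := WeakBimonad {
  bm_ob :> C -> C;
  bm_map : forall X Y : C, hom X Y -> hom (bm_ob X) (bm_ob Y);
  bm_map_comp : forall X Y Z (g : hom Y Z) (f : hom X Y),
    bm_map (g ∙ f) = bm_map g ∙ bm_map f;
  bm_map_id : forall X, bm_map (idm X) = idm (bm_ob X);
  bm_unit : forall X, hom X (bm_ob X);
  bm_mult : forall X, hom (bm_ob (bm_ob X)) (bm_ob X);
  bm_counit : forall X, hom (bm_ob X) X;
  bm_comult : forall X, hom (bm_ob X) (bm_ob (bm_ob X));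
  bm_braid : forall X, hom (bm_ob (bm_ob X)) (bm_ob (bm_ob X));
  bm_braid_inv : forall X, hom (bm_ob (bm_ob X)) (bm_ob (bm_ob X));
  bm_unit_nat : forall X Y (f : hom X Y),
    bm_unit Y ∙ f = bm_map f ∙ bm_unit X;
  bm_mult_nat : forall X Y (f : hom X Y),
    bm_mult Y ∙ bm_map (bm_map f) = bm_map f ∙ bm_mult X;
  bm_counit_nat : forall X Y (f : hom X Y),
    bm_counit Y ∙ bm_map f = f ∙ bm_counit X;
  bm_comult_nat : forall X Y (f : hom X Y),
    bm_comult Y ∙ bm_map f = bm_map (bm_map f) ∙ bm_comult X;
  bm_braid_nat : forall X Y (f : hom X Y),
    bm_braid Y ∙ bm_map (bm_map f) = bm_map (bm_map f) ∙ bm_braid X;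
  bm_braid_inv_nat : forall X Y (f : hom X Y),
    bm_braid_inv Y ∙ bm_map (bm_map f) = bm_map (bm_map f) ∙ bm_braid_inv X;
  bm_unitl : forall X, bm_mult X ∙ bm_unit (bm_ob X) = idm _;
  bm_unitr : forall X, bm_mult X ∙ bm_map (bm_unit X) = idm _;
  bm_counitl : forall X, bm_counit (bm_ob X) ∙ bm_comult X = idm _;
  bm_counitr : forall X, bm_map (bm_counit X) ∙ bm_comult X = idm _;
  bm_coassoc : forall X, bm_comult (bm_ob X) ∙ bm_comult X
    = bm_map (bm_comult X) ∙ bm_comult X;
  bm_braidK : forall X, bm_braid_inv X ∙ bm_braid X = idm _;
  bm_braidVK : forall X, bm_braid X ∙ bm_braid_inv X = idm _;
  bm_yang_baxter : forall X,
    bm_map (bm_braid X) ∙ bm_braid (bm_ob X) ∙ bm_map (bm_braid X)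
    = bm_braid (bm_ob X) ∙ bm_map (bm_braid X) ∙ bm_braid (bm_ob X);
  bm_braid_multl : forall X, bm_braid X ∙ bm_mult (bm_ob X)
    = bm_map (bm_mult X) ∙ bm_braid (bm_ob X) ∙ bm_map (bm_braid X);
  bm_braid_multr : forall X, bm_braid X ∙ bm_map (bm_mult X)
    = bm_mult (bm_ob X) ∙ bm_map (bm_braid X) ∙ bm_braid (bm_ob X);
  bm_braid_unitl : forall X, bm_braid X ∙ bm_unit (bm_ob X) = bm_map (bm_unit X);
  bm_braid_unitr : forall X, bm_braid X ∙ bm_map (bm_unit X) = bm_unit (bm_ob X);
  bm_braid_comultl : forall X, bm_map (bm_comult X) ∙ bm_braid X
    = bm_braid (bm_ob X) ∙ bm_map (bm_braid X) ∙ bm_comult (bm_ob X);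
  bm_braid_comultr : forall X, bm_comult (bm_ob X) ∙ bm_braid X
    = bm_map (bm_braid X) ∙ bm_braid (bm_ob X) ∙ bm_map (bm_comult X);
  bm_braid_counitr : forall X,
    bm_counit (bm_ob X) ∙ bm_braid X = bm_map (bm_counit X);
  bm_a1 : forall X, bm_comult X ∙ bm_mult X
    = bm_mult (bm_ob X) ∙ bm_map (bm_map (bm_mult X)) ∙
      bm_map (bm_braid (bm_ob X)) ∙
      bm_comult (bm_ob (bm_ob X)) ∙ bm_map (bm_comult X);
  bm_a2_assoc : forall X, bm_counit X ∙ bm_mult X ∙ bm_mult (bm_ob X)
    = bm_counit X ∙ bm_mult X ∙ bm_map (bm_mult X);
  bm_a2_split : forall X, bm_counit X ∙ bm_mult X ∙ bm_mult (bm_ob X)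
    = bm_counit X ∙ bm_mult X ∙
      bm_map (bm_map (bm_counit X)) ∙ bm_map (bm_map (bm_mult X)) ∙
      bm_map (bm_braid_inv (bm_ob X)) ∙ bm_map (bm_comult (bm_ob X));
  bm_a3 : forall X, bm_comult (bm_ob X) ∙ bm_comult X ∙ bm_unit X
    = bm_map (bm_mult (bm_ob X)) ∙
      bm_comult _ ∙ bm_unit _ ∙ bm_comult X ∙ bm_unit X
}.

Section Calculus.

Variables (C : category) (B : weak_bimonad C).

Local Notation T := (bm_ob B).
Local Notation "'Tm' f" := (bm_map B f) (at level 10, f at level 9).
Local Notation η := (bm_unit B).
Local Notation μ := (bm_mult B).
Local Notation ε := (bm_counit B).
Local Notation δ := (bm_comult B).
Local Notation c := (bm_braid B).
Local Notation "c⁻¹" := (bm_braid_inv B).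

(** * Rewriting string diagrams *)

Fixpoint iter_ob k X := match k with 0 => X | S k => T (iter_ob k X) end.

Fixpoint iter_map k X Y (f : hom X Y) : hom (iter_ob k X) (iter_ob k Y) :=
  match k return hom (iter_ob k X) (iter_ob k Y) with
  | 0 => f
  | S k => Tm (iter_map k f)
  end.

Lemma iter_map_comp k X Y Z (g : hom Y Z) (f : hom X Y) :
  iter_map k (g ∙ f) = iter_map k g ∙ iter_map k f.
Proof. induction k as [|k IH]; simpl; trivial. now rewrite IH, bm_map_comp. Qed.

(** The form in which an equation of diagrams is used inside a longer one: [k]
    strands run to its left, and [x] is whatever comes before it. *)
Lemma whisker k X Y (f g : hom X Y) Z (x : hom Z (iter_ob k X)) :
  f = g -> iter_map k f ∙ x = iter_map k g ∙ x.
Proof. now intros ->. Qed.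

Lemma slide k A A1 B1 D (a : hom A1 D) (f : hom A A1) (g : hom B1 D) (b : hom A B1) :
  a ∙ f = g ∙ b -> forall Z (x : hom Z (iter_ob k A)),
  iter_map k a ∙ iter_map k f ∙ x = iter_map k g ∙ iter_map k b ∙ x.
Proof. intros E Z x. now rewrite !comp_assoc, <- !iter_map_comp, E. Qed.

(** A generic morphism [x] below both diagrams provides every subdiagram with
    something that precedes it. *)
Lemma cancel_input (X Y : C) (f g : hom X Y) :
  (forall Z (x : hom Z X), f ∙ x = g ∙ x) -> f = g.
Proof. intro E. generalize (E _ (idm X)). now rewrite !comp_idr. Qed.

Ltac flat := rewrite ?bm_map_comp, ?bm_map_id, <- ?comp_assoc, ?comp_idl.
Ltac start := apply cancel_input; intros Z x; flat.

(* Rewrites with [r] to the right of [k] strands. *)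
Tactic Notation "strand" constr(k) "by" uconstr(r) :=
  let E := fresh in
  eassert (E : iter_map k _ ∙ _ = iter_map k _ ∙ _);
  [eapply (@whisker k); eapply r|];
  cbn [iter_ob iter_map] in E;
  rewrite ?bm_map_comp, ?bm_map_id, <- ?comp_assoc, ?comp_idl in E;
  rewrite E; clear E.

Ltac slide_by k N :=
  let E := fresh in
  pose proof (E := fun X Y (f : hom X Y) => @slide k _ _ _ _ _ _ _ _ (N X Y f));
  cbn [iter_ob iter_map] in E; rewrite E; clear E.

Ltac slide_at k :=
  first [ slide_by k (bm_unit_nat B) | slide_by k (bm_mult_nat B)
        | slide_by k (bm_counit_nat B) | slide_by k (bm_comult_nat B)
        | slide_by k (bm_braid_nat B) | slide_by k (bm_braid_inv_nat B)
        | match goal with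
          | N : forall (X Y : _) (f : hom X Y), _ ∙ _ = _ ∙ _ |- _ => slide_by k N
          end ].

(* Of two adjacent independent morphisms, the one on the left strands is moved
   to happen first; naturality hypotheses of the context are used as well. *)
Ltac leftmost_first :=
  repeat first [slide_at 0 | slide_at 1 | slide_at 2 | slide_at 3].

(* Proves that two diagrams agree up to the interchange law. *)
Ltac interchange := flat; leftmost_first; reflexivity.

(** * The morphism ΠL of a weak bimonad *)

Definition bm_PiL X : hom (T X) (T X) :=
  (ε (T X) ∙ μ (T X)) ∙ Tm (c X) ∙ (δ (T X) ∙ η (T X)).

Definition bm_PiR X : hom (T X) (T X) :=
  Tm (ε X ∙ μ X) ∙ c (T X) ∙ Tm (δ X ∙ η X).

Local Notation PiL := bm_PiL.
Local Notation PiR := bm_PiR.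

Lemma PiL_nat X Y (f : hom X Y) : PiL Y ∙ Tm f = Tm f ∙ PiL X.
Proof. unfold bm_PiL; start. interchange. Qed.

Lemma PiR_nat X Y (f : hom X Y) : PiR Y ∙ Tm f = Tm f ∙ PiR X.
Proof. unfold bm_PiR; start. interchange. Qed.

Ltac slide_at k ::=
  first [ slide_by k (bm_unit_nat B) | slide_by k (bm_mult_nat B)
        | slide_by k (bm_counit_nat B) | slide_by k (bm_comult_nat B)
        | slide_by k (bm_braid_nat B) | slide_by k (bm_braid_inv_nat B)
        | slide_by k PiL_nat | slide_by k PiR_nat
        | match goal with
          | N : forall (X Y : _) (f : hom X Y), _ ∙ _ = _ ∙ _ |- _ => slide_by k N
          end ].

(** The counit axiom applied to the product: [x y = ε(x₁ y₁) x₂ y₂]. *)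
Lemma mult_expand X :
  μ X = ε _ ∙ μ _ ∙ Tm (Tm (μ X)) ∙ Tm (c _) ∙ δ _ ∙ Tm (δ X).
Proof. now rewrite <- bm_a1, comp_assoc, bm_counitl, comp_idl. Qed.

(** [ΠL(h₁) h₂ = ε(1₁ h₁) 1₂ h₂] is the expansion of the product [1 h]. *)
Lemma PiL_conv_id X : μ X ∙ PiL (T X) ∙ δ X = idm _.
Proof.
unfold bm_PiL; start.
transitivity (ε _ ∙ μ _ ∙ Tm (Tm (μ X)) ∙ Tm (c _) ∙ δ _ ∙ Tm (δ X) ∙ η _ ∙ x).
{ interchange. }
strand 0 by (eq_sym (mult_expand X)).
strand 0 by (bm_unitl B X). reflexivity.
Qed.

(** The form [ε(x y)] ends in the unit object, whose braiding is trivial; hence a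
    strand that crosses both of its inputs is freed. *)
Lemma pairing_braid X : ε _ ∙ μ _ ∙ Tm (c X) ∙ c _ = Tm (ε X) ∙ Tm (μ X).
Proof. now rewrite <- (bm_braid_multr B X), comp_assoc, (bm_braid_counitr B X). Qed.

Lemma pairing_braid_inv X : ε _ ∙ μ _ ∙ Tm (c X) = Tm (ε X) ∙ Tm (μ X) ∙ c⁻¹ _.
Proof.
start. strand 0 by (eq_sym (pairing_braid X)).
strand 0 by (bm_braidVK B). reflexivity.
Qed.

Lemma yang_baxter_inv X : c⁻¹ _ ∙ Tm (c X) ∙ c _ = Tm (c X) ∙ c _ ∙ Tm (c⁻¹ X).
Proof.
start.
transitivity (c⁻¹ _ ∙ Tm (c X) ∙ c _ ∙ Tm (c X) ∙ Tm (c⁻¹ X) ∙ x).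
{ strand 1 by (bm_braidVK B X). reflexivity. }
strand 0 by (bm_yang_baxter B X).
strand 0 by (bm_braidK B). reflexivity.
Qed.

(** In this form the unit is inserted to the right of the argument, so that a
    product with the second leg of [δ η] can be formed before any crossing. *)
Lemma PiL_braid_inv X : PiL X = ε _ ∙ μ _ ∙ c⁻¹ _ ∙ Tm (δ X) ∙ Tm (η X).
Proof.
unfold bm_PiL; start.
strand 0 by (eq_sym (bm_braid_unitl B X)).
strand 0 by (bm_braid_comultl B X).
strand 0 by (bm_braidK B _). reflexivity.
Qed.

(** [x ⊗ y ↦ ε(x₁ y) x₂], which turns out to be [x ⊗ y ↦ x ΠL(y)]. *)
Definition counit_action X : hom (T (T X)) (T X) := ε _ ∙ μ _ ∙ Tm (c X) ∙ δ _.

Lemma comult_counit_action X :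
  δ X ∙ counit_action X = counit_action _ ∙ Tm (c X) ∙ δ _.
Proof.
unfold counit_action; start.
transitivity (ε _ ∙ μ _ ∙ Tm (Tm (δ X)) ∙ Tm (c X) ∙ δ _ ∙ x).
{ interchange. }
strand 1 by (bm_braid_comultl B X).
strand 0 by (eq_sym (bm_coassoc B _)).
interchange.
Qed.

(** By the form of [cond_a2] that involves the inverse braiding,
    [ε((x z)₁ y) (x z)₂] equals [ε(x₁ z₂) ε(z₁ y) x₂ z₃], which is the expansion of
    the product of [x] and [ε(z₁ y) z₂]. *)
Lemma counit_action_mult X :
  counit_action X ∙ μ _ = μ X ∙ Tm (counit_action X).
Proof.
unfold counit_action; start.
strand 0 by (bm_a1 B _).
transitivity (ε _ ∙ μ _ ∙ μ _ ∙ Tm (Tm (c X)) ∙ Tm (Tm (μ _)) ∙ Tm (c _)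
  ∙ δ _ ∙ Tm (δ _) ∙ x).
{ interchange. }
strand 2 by (bm_braid_multl B X).
strand 0 by (bm_a2_split B _).
leftmost_first.
strand 1 by (bm_braid_comultr B _).
strand 1 by (yang_baxter_inv _).
transitivity (μ X ∙ ε _ ∙ μ _ ∙ Tm (Tm (ε _ ∙ μ _ ∙ Tm (c _) ∙ c _))
  ∙ Tm (Tm (Tm (Tm (c X)))) ∙ Tm (c _) ∙ Tm (Tm (c⁻¹ _))
  ∙ Tm (Tm (δ _)) ∙ Tm (Tm (δ _)) ∙ δ _ ∙ x).
{ interchange. }
flat.
(* The second leg of [x] crosses both factors of [ε(z₁ y)] and is freed. *)
strand 2 by (pairing_braid _).
strand 2 by (bm_coassoc B _).
symmetry.
strand 0 by (mult_expand _).
transitivity (μ X ∙ ε _ ∙ μ _ ∙ Tm (c _) ∙ Tm (Tm (δ X ∙ counit_action X)) ∙ δ _ ∙ x).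
{ unfold counit_action. interchange. }
rewrite comult_counit_action. unfold counit_action.
transitivity (μ X ∙ ε _ ∙ μ _ ∙ Tm (c _)
  ∙ Tm (Tm (ε _ ∙ μ _ ∙ Tm (c _) ∙ Tm (Tm (c _)) ∙ δ _ ∙ δ _)) ∙ δ _ ∙ x).
{ interchange. }
flat.
strand 2 by (pairing_braid_inv _).
strand 2 by (bm_coassoc B _).
interchange.
Qed.

(** The previous lemma at [z = 1]. *)
Lemma mult_PiL X : μ X ∙ Tm (PiL X) = counit_action X.
Proof.
transitivity (μ X ∙ Tm (counit_action X) ∙ Tm (η _)).
{ unfold bm_PiL, counit_action; start. reflexivity. }
start. strand 0 by (eq_sym (counit_action_mult X)).
strand 0 by (bm_unitr B _). reflexivity.
Qed.

(** Expanding the product [1₂ z], replacing [1₁ ⊗ 1₂ ⊗ 1₃] by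
    [1₁ ⊗ 1₂ 1'₁ ⊗ 1'₂] and reassociating under [ε] leaves the coproduct of
    [1' z = z], so that [1₁ ⊗ 1₂ z = 1₁ ⊗ ε(1₂ z₁) z₂]. *)
Lemma unit_expand X :
  Tm (μ X) ∙ δ _ ∙ η _ = Tm (ε _) ∙ Tm (μ _) ∙ Tm (Tm (δ X)) ∙ δ _ ∙ η _.
Proof.
start. strand 1 by (mult_expand X).
transitivity (Tm (ε _ ∙ μ _ ∙ Tm (Tm (μ X)) ∙ Tm (c _)) ∙ Tm (δ _) ∙ δ _ ∙ η _
  ∙ δ X ∙ x).
{ interchange. }
strand 0 by (eq_sym (bm_coassoc B _)).
strand 0 by (bm_a3 B _).
flat.
transitivity (Tm (ε _) ∙ Tm (μ _) ∙ Tm (μ _) ∙ Tm (Tm (Tm (Tm (μ X))))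
  ∙ Tm (Tm (Tm (c _))) ∙ δ _ ∙ η _ ∙ δ _ ∙ η _ ∙ δ _ ∙ x).
{ interchange. }
strand 1 by (bm_a2_assoc B _).
transitivity (Tm (ε _ ∙ μ _) ∙ δ _ ∙ η _ ∙ μ _ ∙ Tm (Tm (μ X)) ∙ Tm (c _) ∙ δ _
  ∙ Tm (δ X) ∙ η _ ∙ x).
{ interchange. }
strand 0 by (eq_sym (bm_a1 B X)).
strand 0 by (bm_unitl B X).
interchange.
Qed.

(** In [ΠL(y) z = ε(1₁ y) 1₂ z] only the second leg of the coproduct of [1] meets
    [z], and [unit_expand] applies to it. *)
Lemma PiL_mult X : μ X ∙ PiL (T X) = ε _ ∙ μ _ ∙ PiL _ ∙ Tm (δ X).
Proof.
rewrite !PiL_braid_inv; start.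
transitivity (ε _ ∙ μ _ ∙ c⁻¹ _ ∙ Tm (Tm (μ X) ∙ δ _ ∙ η _) ∙ x).
{ interchange. }
rewrite unit_expand. interchange.
Qed.

(** By the previous lemma, left multiplication by [ΠL(y)] has the form
    [z ↦ u(z₁) z₂] for a functional [u], hence it is colinear. *)
Lemma PiL_mult_comult X : δ X ∙ μ X ∙ PiL (T X) = μ _ ∙ PiL _ ∙ Tm (δ X).
Proof.
start. strand 0 by (PiL_mult X).
transitivity (ε _ ∙ μ _ ∙ PiL _ ∙ Tm (δ _) ∙ Tm (δ X) ∙ x).
{ strand 1 by (bm_coassoc B _). interchange. }
strand 0 by (eq_sym (PiL_mult (T X))). reflexivity.
Qed.

Lemma braid_PiL X : c X ∙ Tm (PiL X) = PiL _ ∙ c X.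
Proof.
unfold bm_PiL; start.
strand 0 by (eq_sym (pairing_braid _)).
transitivity (ε _ ∙ μ _ ∙ Tm (Tm (c X)) ∙ Tm (c _) ∙ Tm (Tm (c X)) ∙ c _
  ∙ Tm (δ _) ∙ Tm (η _) ∙ x).
{ interchange. }
strand 1 by (bm_yang_baxter B _).
strand 0 by (eq_sym (bm_braid_comultr B _)).
strand 0 by (bm_braid_unitr B _).
interchange.
Qed.

(** The two sides expand to [ε((x₁ ΠL(y)) z₁) x₂ z₂] and
    [ε(x₁ (ΠL(y) z₁)) x₂ z₂], and products associate under [ε]. *)
Lemma PiL_middle X : μ X ∙ μ _ ∙ Tm (PiL _) = μ X ∙ Tm (μ X) ∙ Tm (PiL _).
Proof.
start.
transitivity (ε _ ∙ μ _ ∙ μ _ ∙ Tm (PiL _) ∙ Tm (Tm (Tm (μ X))) ∙ Tm (Tm (c _))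
  ∙ Tm (c _) ∙ δ _ ∙ Tm (Tm (δ X)) ∙ x).
{ strand 0 by (mult_expand X).
  strand 0 by (mult_PiL _).
  transitivity (ε _ ∙ μ _ ∙ Tm (Tm (μ X)) ∙ Tm (c _) ∙ δ _ ∙ counit_action _
    ∙ Tm (Tm (δ X)) ∙ x).
  { unfold counit_action. interchange. }
  strand 0 by (comult_counit_action _).
  strand 0 by (mult_PiL _).
  unfold counit_action; interchange. }
strand 0 by (bm_a2_assoc B _).
symmetry.
strand 0 by (mult_expand X).
strand 1 by (PiL_mult_comult X).
transitivity (ε _ ∙ μ _ ∙ Tm (Tm (μ X)) ∙ Tm (c _) ∙ Tm (Tm (μ _)) ∙ δ _
  ∙ Tm (PiL _) ∙ Tm (Tm (δ X)) ∙ x).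
{ interchange. }
strand 1 by (bm_braid_multr B _).
transitivity (ε _ ∙ μ _ ∙ Tm (Tm (μ X)) ∙ Tm (μ _) ∙ Tm (Tm (c _)) ∙ Tm (c _)
  ∙ Tm (Tm (PiL _)) ∙ δ _ ∙ Tm (Tm (δ X)) ∙ x).
{ interchange. }
strand 1 by (braid_PiL _).
interchange.
Qed.

(** The two sides expand to [ε((ΠL(z) y₁) x₁) y₂ x₂] and
    [ε(ΠL(z) (y₁ x₁)) y₂ x₂]. *)
Lemma PiL_left X : μ X ∙ μ _ ∙ PiL _ = μ X ∙ Tm (μ X) ∙ PiL _.
Proof.
start.
transitivity (ε _ ∙ μ _ ∙ μ _ ∙ PiL _ ∙ Tm (Tm (Tm (μ X))) ∙ Tm (Tm (c _))
  ∙ Tm (δ _) ∙ Tm (Tm (δ X)) ∙ x).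
{ strand 0 by (mult_expand X).
  transitivity (ε _ ∙ μ _ ∙ Tm (Tm (μ X)) ∙ Tm (c _) ∙ δ _ ∙ μ _ ∙ PiL _
    ∙ Tm (Tm (δ X)) ∙ x).
  { interchange. }
  strand 0 by (PiL_mult_comult _).
  interchange. }
strand 0 by (bm_a2_assoc B _).
symmetry.
transitivity (μ X ∙ PiL _ ∙ Tm (μ X) ∙ x).
{ interchange. }
strand 0 by (PiL_mult X).
strand 1 by (bm_a1 B X).
interchange.
Qed.

(** * Galois morphism and antipode of a weak bimonad *)

Definition bm_galois X := μ _ ∙ Tm (δ X).

Definition bm_Omega (P : forall X, hom (T X) (T X)) X :=
  μ _ ∙ Tm (P _) ∙ Tm (δ X).

Record bm_galois_inverse (phi : forall X, hom (T (T X)) (T (T X))) : Prop := {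
  gi_nat : forall X Y (f : hom X Y), phi Y ∙ Tm (Tm f) = Tm (Tm f) ∙ phi X;
  gi_left : forall X, phi X ∙ bm_galois X = bm_Omega PiL X;
  gi_right : forall X, bm_galois X ∙ phi X = bm_Omega PiR X;
  gi_OmegaR : forall X, phi X ∙ bm_Omega PiR X = phi X;
  gi_OmegaL : forall X, bm_Omega PiL X ∙ phi X = phi X;
  gi_linear : forall X, phi X = μ _ ∙ Tm (phi X) ∙ Tm (η _)
}.

(** The axioms of an antipode that only involve right multiplication by its
    values; the mirror image contains the others. *)
Record bm_antipode (lam : forall X, hom (T X) (T X)) : Prop := {
  ap_nat : forall X Y (f : hom X Y), lam Y ∙ Tm f = Tm f ∙ lam X;
  ap_conv_PiL : forall X, μ X ∙ lam _ ∙ Tm (PiL X) ∙ δ X = lam X;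
  ap_PiR_conv : forall X, μ X ∙ PiR _ ∙ Tm (lam X) ∙ δ X = lam X;
  ap_cancelL : forall X, μ X ∙ μ _ ∙ Tm (Tm (lam _)) ∙ Tm (δ X) = μ X ∙ Tm (PiL X);
  ap_cancelR : forall X, μ X ∙ μ _ ∙ Tm (lam _) ∙ Tm (δ X) = μ X ∙ Tm (PiR X)
}.

Lemma bm_antipode_ext lam lam' :
  (forall X, lam' X = lam X) -> bm_antipode lam -> bm_antipode lam'.
Proof.
intros E [h1 h2 h3 h4 h5]; constructor; intros; rewrite !E; trivial.
Qed.

(** These are the cancellation axioms with [1] as the left factor. *)
Lemma antipode_conv lam : bm_antipode lam -> forall X,
  μ X ∙ Tm (lam X) ∙ δ X = PiL X /\ μ X ∙ lam _ ∙ δ X = PiR X.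
Proof.
intros [lam_nat _ _ cancelL cancelR] X.
split; start.
- transitivity (μ X ∙ μ _ ∙ Tm (Tm (lam X)) ∙ Tm (δ X) ∙ η _ ∙ x).
  + transitivity (μ X ∙ μ _ ∙ η _ ∙ Tm (lam X) ∙ δ X ∙ x).
    * strand 0 by (bm_unitl B _). reflexivity.
    * interchange.
  + strand 0 by (cancelL X). strand 0 by (eq_sym (bm_unit_nat B (PiL X))).
    strand 0 by (bm_unitl B _). reflexivity.
- transitivity (μ X ∙ μ _ ∙ Tm (lam _) ∙ Tm (δ X) ∙ η _ ∙ x).
  + transitivity (μ X ∙ μ _ ∙ η _ ∙ lam _ ∙ δ X ∙ x).
    * strand 0 by (bm_unitl B _). reflexivity.
    * interchange.
  + strand 0 by (cancelR X). strand 0 by (eq_sym (bm_unit_nat B (PiR X))).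
    strand 0 by (bm_unitl B _). reflexivity.
Qed.

(** [λ = ΠR ∗ λ = (λ' ∗ id) ∗ λ = λ' ∗ ΠL = λ'], where the third equality is
    [(x h₁) λ(h₂) = x ΠL(h)] at [x = λ'(h)].  Of [λ'] only convolution identities
    are required, which an antipode of the mirror image satisfies as well. *)
Lemma antipode_unique lam lam' X :
  bm_antipode lam ->
  (forall X Y (f : hom X Y), lam' Y ∙ Tm f = Tm f ∙ lam' X) ->
  (forall X, μ X ∙ lam' (T X) ∙ δ X = PiR X) ->
  μ X ∙ lam' _ ∙ Tm (PiL X) ∙ δ X = lam' X ->
  lam X = lam' X.
Proof.
intros [lam_nat _ PiR_conv cancelL _] lam'_nat conv_id conv_PiL.
rewrite <- PiR_conv, <- conv_id, <- conv_PiL. start.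
transitivity (μ X ∙ μ _ ∙ Tm (Tm (lam _)) ∙ lam' _ ∙ δ _ ∙ δ X ∙ x).
{ interchange. }
strand 0 by (bm_coassoc B X).
transitivity (μ X ∙ μ _ ∙ Tm (Tm (lam _)) ∙ Tm (δ X) ∙ lam' _ ∙ δ X ∙ x).
{ interchange. }
strand 0 by (cancelL X). interchange.
Qed.

(** [(x ΠL(h₁)) h₂ = x (ΠL(h₁) h₂) = x h]. *)
Lemma galois_OmegaL X : bm_galois X ∙ bm_Omega PiL X = bm_galois X.
Proof.
unfold bm_galois, bm_Omega; start.
transitivity (μ _ ∙ μ _ ∙ Tm (PiL _) ∙ Tm (Tm (δ X)) ∙ Tm (δ X) ∙ x).
{ interchange. }
strand 0 by (PiL_middle _).
strand 1 by (eq_sym (bm_coassoc B _)).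
strand 1 by (PiL_conv_id _).
reflexivity.
Qed.

Lemma counit_Omega (P : forall X, hom (T X) (T X)) X :
  (forall X Y (f : hom X Y), P Y ∙ Tm f = Tm f ∙ P X) ->
  Tm (ε X) ∙ bm_Omega P X = μ X ∙ Tm (P X).
Proof.
intro P_nat. unfold bm_Omega; start.
strand 0 by (eq_sym (bm_mult_nat B (ε X))).
strand 1 by (eq_sym (P_nat _ _ (ε X))).
strand 1 by (bm_counitr B X). reflexivity.
Qed.

(** An almost linear inverse is [x ⊗ h ↦ x λ(h₁) ⊗ h₂] with
    [λ(h) = (id ⊗ ε) φ(1 ⊗ h)], because it inherits colinearity from [β].
    The equations of [φ] then become, after applying [id ⊗ ε] and in part setting
    [x = 1], the axioms of an antipode. *)
Lemma galois_inverse_antipode phi : bm_galois_inverse phi ->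
  bm_antipode (fun X => Tm (ε X) ∙ phi X ∙ η _).
Proof.
intros [phi_nat left right OmegaR OmegaL linear].
set (lam := fun X => _).
assert (lam_nat : forall X Y (f : hom X Y), lam Y ∙ Tm f = Tm f ∙ lam X).
{ intros; unfold lam; start; interchange. }
(* [δ φ = δ φ β φ = φ δ β φ = φ δ Ω_R = φ δ], since [β], [Ω_L = φ β] and [Ω_R]
   are colinear by coassociativity. *)
assert (colinear : forall X, Tm (δ X) ∙ phi X = phi _ ∙ Tm (δ X)).
{ intro X.
  assert (colL : Tm (δ X) ∙ bm_Omega PiL X = bm_Omega PiL _ ∙ Tm (δ X)).
  { unfold bm_Omega; start. strand 1 by (bm_coassoc B _). interchange. }
  assert (colR : Tm (δ X) ∙ bm_Omega PiR X = bm_Omega PiR _ ∙ Tm (δ X)).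
  { unfold bm_Omega; start. strand 1 by (bm_coassoc B _). interchange. }
  assert (colG : Tm (δ X) ∙ bm_galois X = bm_galois _ ∙ Tm (δ X)).
  { unfold bm_galois; start. strand 1 by (bm_coassoc B _). interchange. }
  transitivity (Tm (δ X) ∙ bm_Omega PiL X ∙ phi X); [now rewrite OmegaL|].
  rewrite comp_assoc, colL, <- left, <- !comp_assoc.
  rewrite (comp_assoc (bm_galois _) _ _), <- colG, <- comp_assoc, right, colR.
  now rewrite comp_assoc, OmegaR. }
assert (phi_lam : forall X, phi X = bm_Omega lam X).
{ intro X. unfold bm_Omega.
  transitivity (Tm (ε _) ∙ phi _ ∙ Tm (δ X)).
  - rewrite <- colinear. start. strand 1 by (bm_counitl B X). reflexivity.
  - rewrite linear. unfold lam. start. interchange. }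
constructor; trivial.
- intro X. unfold lam at 2.
  rewrite <- OmegaL, phi_lam, <- (comp_assoc (bm_Omega _ _)),
    (comp_assoc (Tm (ε X)) (bm_Omega _ _)), counit_Omega; [|exact PiL_nat].
  unfold bm_Omega. start.
  transitivity (μ X ∙ Tm (PiL X) ∙ μ _ ∙ η _ ∙ lam _ ∙ δ X ∙ x).
  + strand 0 by (bm_unitl B _). interchange.
  + interchange.
- intro X. unfold lam at 2.
  rewrite <- OmegaR, phi_lam, <- (comp_assoc (bm_Omega _ _)),
    (comp_assoc (Tm (ε X)) (bm_Omega _ _)), counit_Omega; [|exact lam_nat].
  unfold bm_Omega. start.
  transitivity (μ X ∙ Tm (lam X) ∙ μ _ ∙ η _ ∙ PiR _ ∙ δ X ∙ x).
  + strand 0 by (bm_unitl B _). interchange.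
  + interchange.
- intro X. transitivity (Tm (ε X) ∙ phi _ ∙ bm_galois _).
  + rewrite phi_lam. unfold bm_Omega, bm_galois; start.
    transitivity (Tm (ε _) ∙ μ _ ∙ μ _ ∙ Tm (Tm (lam _)) ∙ Tm (Tm (δ _))
      ∙ Tm (δ X) ∙ x).
    * strand 0 by (eq_sym (bm_mult_nat B (ε X))).
      strand 0 by (eq_sym (bm_mult_nat B (Tm (ε X)))).
      strand 2 by (eq_sym (lam_nat _ _ (ε X))).
      strand 2 by (bm_counitr B X). reflexivity.
    * interchange.
  + rewrite left. apply counit_Omega, PiL_nat.
- intro X. transitivity (Tm (ε X) ∙ bm_galois _ ∙ phi _).
  + rewrite phi_lam. unfold bm_Omega, bm_galois; start.
    transitivity (Tm (ε _) ∙ μ _ ∙ μ _ ∙ Tm (Tm (δ _)) ∙ Tm (lam _)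
      ∙ Tm (δ X) ∙ x).
    * strand 0 by (eq_sym (bm_mult_nat B (ε X))).
      strand 0 by (eq_sym (bm_mult_nat B (Tm (ε X)))).
      strand 2 by (bm_counitr B X). reflexivity.
    * interchange.
  + rewrite right. apply counit_Omega, PiR_nat.
Qed.

Section RightHanded.

(** The counterparts of [PiL_middle], [PiL_left] and [PiL_conv_id] for [ΠR]; they
    hold as soon as the mirror image is a weak bimonad too. *)
Hypothesis PiR_middle : forall X,
  μ X ∙ μ _ ∙ Tm (PiR _) = μ X ∙ Tm (μ X) ∙ Tm (PiR _).
Hypothesis PiR_right : forall X,
  μ X ∙ μ _ ∙ Tm (Tm (PiR X)) = μ X ∙ Tm (μ X) ∙ Tm (Tm (PiR X)).
Hypothesis id_conv_PiR : forall X, μ X ∙ Tm (PiR X) ∙ δ X = idm _.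

(** [(x h₁) ΠR(h₂) = x (h₁ ΠR(h₂)) = x h]. *)
Lemma OmegaR_galois X : bm_Omega PiR X ∙ bm_galois X = bm_galois X.
Proof.
unfold bm_galois, bm_Omega; start.
transitivity (μ _ ∙ μ _ ∙ Tm (Tm (PiR _)) ∙ Tm (Tm (δ X)) ∙ Tm (δ X) ∙ x).
{ interchange. }
strand 0 by (PiR_right _).
strand 1 by (eq_sym (bm_coassoc B _)).
strand 1 by (id_conv_PiR _).
reflexivity.
Qed.

(** For [φ(x ⊗ h) = x λ(h₁) ⊗ h₂] the cancellation axioms are [φ β = Ω_L] and
    [β φ = Ω_R], while [φ Ω_R = φ] reduces to [ΠR ∗ λ = λ] since elements of the
    image of [ΠR] associate in the middle. *)
Lemma antipode_galois_inverse lam :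
  bm_antipode lam -> bm_galois_inverse (bm_Omega lam).
Proof.
intros [lam_nat _ PiR_conv cancelL cancelR].
assert (left : forall X, bm_Omega lam X ∙ bm_galois X = bm_Omega PiL X).
{ intro X. unfold bm_galois, bm_Omega; start.
  transitivity (μ _ ∙ μ _ ∙ Tm (Tm (lam _)) ∙ Tm (Tm (δ X)) ∙ Tm (δ X) ∙ x).
  { interchange. }
  strand 1 by (eq_sym (bm_coassoc B _)).
  strand 0 by (cancelL _). reflexivity. }
assert (right : forall X, bm_galois X ∙ bm_Omega lam X = bm_Omega PiR X).
{ intro X. unfold bm_galois, bm_Omega; start.
  transitivity (μ _ ∙ μ _ ∙ Tm (lam _) ∙ Tm (Tm (δ X)) ∙ Tm (δ X) ∙ x).
  { interchange. }
  strand 1 by (eq_sym (bm_coassoc B _)).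
  strand 0 by (cancelR _). reflexivity. }
assert (OmegaR : forall X, bm_Omega lam X ∙ bm_Omega PiR X = bm_Omega lam X).
{ intro X. unfold bm_Omega; start.
  transitivity (μ _ ∙ μ _ ∙ Tm (PiR _) ∙ Tm (Tm (lam _)) ∙ Tm (Tm (δ X))
    ∙ Tm (δ X) ∙ x).
  { interchange. }
  strand 0 by (PiR_middle _).
  strand 1 by (eq_sym (bm_coassoc B _)).
  strand 1 by (PiR_conv _). reflexivity. }
constructor; trivial.
- intros; unfold bm_Omega; start; interchange.
- intro X. rewrite <- left, <- comp_assoc, right. apply OmegaR.
- intro X; unfold bm_Omega; start.
  transitivity (μ _ ∙ Tm (μ _) ∙ Tm (η _) ∙ Tm (lam _) ∙ Tm (δ X) ∙ x).
  + strand 1 by (bm_unitl B _). reflexivity.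
  + interchange.
Qed.

End RightHanded.

End Calculus.

(** * Equality of morphisms up to strictness *)

Section Arrows.

Variable C : category.

Lemma transport_arrow (A B A' B' : C) (f : hom A B) (eA : A = A') (eB : B = B') :
  transport_hom f eA eB ≡ f.
Proof. now destruct eA, eB. Qed.

Lemma arrow_transport (A B A' B' : C) (f : hom A B) (g : hom A' B') :
  f ≡ g -> exists (eA : A = A') (eB : B = B'), g = transport_hom f eA eB.
Proof.
intro E.
change (exists (eA : source (Arrow f) = source (Arrow g))
  (eB : target (Arrow f) = target (Arrow g)),
  mor (Arrow g) = transport_hom (mor (Arrow f)) eA eB).
rewrite <- E. now exists eq_refl, eq_refl.
Qed.

Lemma arrow_inj (A B : C) (f g : hom A B) : f ≡ g -> f = g.
Proof.
intro E. destruct (arrow_transport E) as (eA & eB & ->).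
now rewrite (proof_irrelevance _ eA eq_refl), (proof_irrelevance _ eB eq_refl).
Qed.

Lemma comp_arrow (A B D A' B' D' : C) (g : hom B D) (f : hom A B)
  (g' : hom B' D') (f' : hom A' B') : g ≡ g' -> f ≡ f' -> g ∙ f ≡ g' ∙ f'.
Proof.
intros Eg Ef.
destruct (arrow_transport Eg) as (eB & eD & ->).
destruct (arrow_transport Ef) as (eA & eB' & ->).
destruct eA, eD, eB'.
now rewrite (proof_irrelevance _ eB eq_refl).
Qed.

Lemma compose_arrow (A B B' D A0 B0 B0' D0 : C)
  (g : hom B' D) (f : hom A B) (e : B = B')
  (g0 : hom B0' D0) (f0 : hom A0 B0) (e0 : B0 = B0') :
  g ≡ g0 -> f ≡ f0 -> compose g f e ≡ compose g0 f0 e0.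
Proof.
intros Eg Ef. apply comp_arrow; trivial.
now rewrite !transport_arrow.
Qed.

End Arrows.

(** * Morphisms between tensor powers as natural transformations *)

Section Action.

Variables (C : strict_monoidal_category) (H : C).

Lemma tensm_arrow (A B A' B' A0 B0 A0' B0' : C) (f : hom A B) (g : hom A' B')
  (f0 : hom A0 B0) (g0 : hom A0' B0') : f ≡ f0 -> g ≡ g0 -> f ⊗ g ≡ f0 ⊗ g0.
Proof.
intros Ef Eg.
destruct (arrow_transport Ef) as (e1 & e2 & ->).
destruct (arrow_transport Eg) as (e3 & e4 & ->).
now destruct e1, e2, e3, e4.
Qed.

Lemma tensm_idl_comp (X Y Z : C) (g : hom Y Z) (f : hom X Y) :
  idm H ⊗ (g ∙ f) = (idm H ⊗ g) ∙ (idm H ⊗ f).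
Proof. now rewrite <- tensm_comp, comp_idl. Qed.

Fixpoint power_ob n (X : C) : C :=
  match n with 0 => X | S n => (H ⊗ power_ob n X)%ob end.

Fixpoint power_map n X Y (f : hom X Y) : hom (power_ob n X) (power_ob n Y) :=
  match n return hom (power_ob n X) (power_ob n Y) with
  | 0 => f
  | S n => idm H ⊗ power_map n f
  end.

Lemma power_map_id n X : power_map n (idm X) = idm _.
Proof. induction n as [|n IH]; simpl; trivial. now rewrite IH, tensm_id. Qed.

Lemma power_map_add n m X Y (f : hom X Y) :
  power_map (n + m) f ≡ power_map n (power_map m f).
Proof. induction n as [|n IH]; simpl; trivial. now apply tensm_arrow. Qed.

Lemma power_map_arrow n X Y X' Y' (f : hom X Y) (f' : hom X' Y') :
  f ≡ f' -> power_map n f ≡ power_map n f'.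
Proof. intro E. destruct (arrow_transport E) as (e1 & e2 & ->). now destruct e1, e2. Qed.

(** [A] is a bracketing of the [n]-th tensor power of [H].  The functors [A ⊗ -]
    and the [n]-fold [H ⊗ -] are compared on morphisms, because equal values on
    objects would not make actions natural. *)
Definition is_power n (A : C) := forall X Y (f : hom X Y), idm A ⊗ f ≡ power_map n f.

Lemma is_power_unit : is_power 0 unit_ob.
Proof. intros X Y f. apply tensm_unitl. Qed.

Lemma is_power_one : is_power 1 H.
Proof. intros X Y f. reflexivity. Qed.

Lemma is_power_tens n m A B :
  is_power n A -> is_power m B -> is_power (n + m) (A ⊗ B)%ob.
Proof.
intros pA pB X Y f.
rewrite power_map_add, <- tensm_id, tensm_assoc, pA.
apply power_map_arrow, pB.
Qed.

Lemma is_power_ob n A : is_power n A -> forall X, (A ⊗ X)%ob = power_ob n X.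
Proof. intros p X. exact (f_equal (fun a => source a) (p _ _ (idm X))). Qed.

(** [f ⊗ -], transported once and for all to functors that compose by
    computation. *)
Definition action n m A B (pA : is_power n A) (pB : is_power m B) (f : hom A B) X :
  hom (power_ob n X) (power_ob m X) :=
  transport_hom (f ⊗ idm X) (is_power_ob pA X) (is_power_ob pB X).

Lemma action_nat n m A B (pA : is_power n A) (pB : is_power m B) (f : hom A B)
  X Y (h : hom X Y) :
  action pA pB f Y ∙ power_map n h = power_map m h ∙ action pA pB f X.
Proof.
apply arrow_inj.
transitivity (Arrow (f ⊗ h)).
- transitivity (Arrow ((f ⊗ idm Y) ∙ (idm A ⊗ h))).
  + apply comp_arrow; [apply transport_arrow|]. now rewrite pA.
  + now rewrite <- tensm_comp, comp_idl, comp_idr.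
- transitivity (Arrow ((idm B ⊗ h) ∙ (f ⊗ idm X))).
  + now rewrite <- tensm_comp, comp_idl, comp_idr.
  + apply comp_arrow; [now rewrite pB|]. symmetry. apply transport_arrow.
Qed.

(** [F] is [f ⊗ -].  The source and target functors are left arbitrary: for a
    concrete diagram all their bracketings are convertible, so that the lemmas
    below compose with no transport. *)
Definition acts_as (A B : C) (SA SB : C -> C) (f : hom A B)
  (F : forall X, hom (SA X) (SB X)) : Prop :=
  forall X, f ⊗ idm X ≡ F X.

Lemma acts_as_action n m A B (pA : is_power n A) (pB : is_power m B) (f : hom A B) :
  acts_as f (action pA pB f).
Proof. intro X. symmetry. apply transport_arrow. Qed.

Lemma acts_as_id n A : is_power n A -> acts_as (idm A) (fun X => idm (power_ob n X)).
Proof. intros p X. rewrite p. now rewrite power_map_id. Qed.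

Lemma acts_as_comp (A B D : C) (SA SB SD : C -> C) (g : hom B D) (f : hom A B)
  (G : forall X, hom (SB X) (SD X)) (F : forall X, hom (SA X) (SB X)) :
  acts_as f F -> acts_as g G -> acts_as (g ∙ f) (fun X => G X ∙ F X).
Proof.
intros aF aG X. rewrite <- (comp_idl (idm X)), tensm_comp.
now apply comp_arrow.
Qed.

Lemma acts_as_transport (A B A' B' : C) (SA SB : C -> C) (f : hom A B)
  (F : forall X, hom (SA X) (SB X)) (eA : A = A') (eB : B = B') :
  acts_as f F -> acts_as (transport_hom f eA eB) F.
Proof. now destruct eA, eB. Qed.

Lemma acts_as_compose (A B B' D : C) (SA SB SD : C -> C)
  (g : hom B' D) (f : hom A B) (e : B = B')
  (G : forall X, hom (SB X) (SD X)) (F : forall X, hom (SA X) (SB X)) :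
  acts_as f F -> acts_as g G -> acts_as (compose g f e) (fun X => G X ∙ F X).
Proof. intros aF aG. apply acts_as_comp; trivial. now apply acts_as_transport. Qed.

Lemma acts_as_tens n (A B A' B' : C) (SB SA' SB' : C -> C)
  (f : hom A B) (g : hom A' B')
  (F : forall X, hom (power_ob n X) (SB X)) (G : forall X, hom (SA' X) (SB' X)) :
  is_power n A -> acts_as f F -> acts_as g G ->
  acts_as (f ⊗ g) (fun X => F (SB' X) ∙ power_map n (G X)).
Proof.
intros p aF aG X.
rewrite tensm_assoc.
transitivity (Arrow ((f ⊗ idm _) ∙ (idm A ⊗ (g ⊗ idm X)))).
- now rewrite <- tensm_comp, comp_idl, comp_idr.
- apply comp_arrow.
  + transitivity (Arrow (f ⊗ idm (SB' X))); [|apply aF].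
    apply tensm_arrow; trivial.
    pose proof (f_equal (fun a => target a) (aG X)) as E; simpl in E.
    now rewrite E.
  + rewrite p. apply power_map_arrow, aG.
Qed.

Lemma acts_as_eq (A B A' B' : C) (SA SB : C -> C) (f : hom A B) (g : hom A' B')
  (F G : forall X, hom (SA X) (SB X)) :
  f ≡ g -> acts_as f F -> acts_as g G -> forall X, F X = G X.
Proof.
intros E aF aG X. apply arrow_inj. rewrite <- aF, <- aG.
now apply tensm_arrow.
Qed.

(** A morphism is recovered from its action on the unit object. *)
Lemma acts_as_faithful (A B A' B' : C) (SA SB : C -> C) (f : hom A B) (g : hom A' B')
  (F G : forall X, hom (SA X) (SB X)) :
  acts_as f F -> acts_as g G -> (forall X, F X = G X) -> f ≡ g.
Proof.
intros aF aG E.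
transitivity (Arrow (f ⊗ idm unit_ob)); [symmetry; apply tensm_unitr|].
transitivity (Arrow (g ⊗ idm unit_ob)); [|apply tensm_unitr].
now rewrite aF, aG, E.
Qed.

End Action.

Ltac power_proof H A :=
  lazymatch A with
  | H => constr:(is_power_one H)
  | unit_ob => constr:(is_power_unit H)
  | tens ?A ?B =>
      let p := power_proof H A in let q := power_proof H B in
      constr:(is_power_tens p q)
  end.

(* The proof of [acts_as e F], for the [F] computed from the expression [e] by
   replacing each constant or variable in it by its action. *)
Ltac acts_as_proof_in C H e :=
  lazymatch e with
  | @compose _ ?A ?B ?B' ?D ?g ?f ?p =>
      let aF := acts_as_proof_in C H f in let aG := acts_as_proof_in C H g in
      constr:(acts_as_compose (C := C) (B := B) (B' := B') p aF aG)
  | comp ?g ?f =>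
      let aF := acts_as_proof_in C H f in let aG := acts_as_proof_in C H g in
      constr:(acts_as_comp (C := C) aF aG)
  | transport_hom ?f ?p ?q =>
      let aF := acts_as_proof_in C H f in
      constr:(acts_as_transport (C := C) p q aF)
  | @tensm _ ?A _ _ _ ?f ?g =>
      let p := power_proof H A in
      let aF := acts_as_proof_in C H f in let aG := acts_as_proof_in C H g in
      constr:(acts_as_tens (C := C) p aF aG)
  | idm ?A => let p := power_proof H A in constr:(acts_as_id p)
  | ?f =>
      lazymatch type of f with hom ?A ?B =>
        let p := power_proof H A in let q := power_proof H B in
        constr:(acts_as_action p q f)
      end
  end.

Ltac acts_as_proof H e :=
  let p := constr:(is_power_one H) in
  lazymatch type of p with @is_power ?C _ _ _ => acts_as_proof_in C H e end.

Ltac flatten_in E :=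
  cbn [power_map power_ob Nat.add] in E;
  repeat (progress rewrite ?tensm_id, ?comp_idl, ?comp_idr, ?tensm_idl_comp in E);
  rewrite <- ?comp_assoc in E.

Ltac flatten :=
  cbn [power_map power_ob Nat.add];
  repeat (progress rewrite ?tensm_id, ?comp_idl, ?comp_idr, ?tensm_idl_comp);
  rewrite <- ?comp_assoc.

(* From an equation [h] of morphisms, the equation [E] of their actions at [X]. *)
Ltac act_on H h X E :=
  lazymatch type of h with
  | Arrow ?f = Arrow ?g =>
    let aF := acts_as_proof H f in let aG := acts_as_proof H g in
    pose proof (E := acts_as_eq h aF aG X)
  | ?f = ?g =>
    let aF := acts_as_proof H f in let aG := acts_as_proof H g in
    pose proof (E := acts_as_eq (f_equal Arrow h) aF aG X)
  end; flatten_in E.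

Ltac exact_action H h X := let E := fresh in act_on H h X E; flatten; exact E.

(* Reduces an equation of morphisms to that of their actions at a generic [X]. *)
Ltac by_action H :=
  lazymatch goal with
  | |- Arrow ?f = Arrow ?g =>
    let aF := acts_as_proof H f in let aG := acts_as_proof H g in
    apply (acts_as_faithful aF aG); intro X; flatten
  | |- _ = _ => apply arrow_inj; by_action H
  end.

(** * The weak bimonad [H ⊗ -] *)

Section Bimonad.

Variables (C : strict_braided_monoidal_category) (H : C).

Local Notation p0 := (is_power_unit H).
Local Notation p1 := (is_power_one H).
Local Notation p2 := (is_power_tens (is_power_one H) (is_power_one H)).

Lemma braid_ob (A B A' B' : C) : A = A' -> B = B' -> braid A B ≡ braid A' B'.
Proof. now intros -> ->. Qed.

(** The braiding with the unit is trivial: by the hexagon it is idempotent, since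
    [K ⊗ K = K], and it is invertible. *)
Lemma action_braid_unitr X :
  action (is_power_tens p1 p0) (is_power_tens p0 p1) (braid H unit_ob) X = idm _.
Proof.
assert (hexagon : (idm unit_ob ⊗ braid H unit_ob) ∘ (braid H unit_ob ⊗ idm unit_ob)
   ≡ braid H unit_ob).
{ transitivity (Arrow (braid H (unit_ob ⊗ unit_ob)%ob)).
  - rewrite braid_tensr. now apply compose_arrow.
  - apply braid_ob; trivial. apply tens_unitl. }
act_on H hexagon X E.
pose proof (proj1 (braidK H unit_ob)) as K.
act_on H K X E'.
etransitivity; [symmetry; apply comp_idl|].
etransitivity; [apply (f_equal (fun h => h ∙ _)); symmetry; exact E'|].
rewrite <- comp_assoc. etransitivity; [apply f_equal, E|]. exact E'.
Qed.

Lemma action_braid_unitl X :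
  action (is_power_tens p0 p1) (is_power_tens p1 p0) (braid unit_ob H) X = idm _.
Proof.
assert (hexagon : (braid unit_ob H ⊗ idm unit_ob) ∘ (idm unit_ob ⊗ braid unit_ob H)
   ≡ braid unit_ob H).
{ transitivity (Arrow (braid (unit_ob ⊗ unit_ob)%ob H)).
  - rewrite braid_tensl. now apply compose_arrow.
  - apply braid_ob; trivial. apply tens_unitl. }
act_on H hexagon X E.
pose proof (proj1 (braidK unit_ob H)) as K.
act_on H K X E'.
etransitivity; [symmetry; apply comp_idl|].
etransitivity; [apply (f_equal (fun h => h ∙ _)); symmetry; exact E'|].
rewrite <- comp_assoc. etransitivity; [apply f_equal, E|]. exact E'.
Qed.

Variables (M : unital_magma H) (D : comonoid H).
Hypotheses (ha1 : cond_a1 M D) (ha2 : cond_a2 M D) (ha3 : cond_a3 M D).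

Definition tens_bimonad : weak_bimonad C.
Proof.
refine (@WeakBimonad C (fun X => (H ⊗ X)%ob) (fun X Y f => idm H ⊗ f) _ _
 (action p0 p1 (eta M)) (action p2 p1 (mu M))
 (action p1 p0 (eps D)) (action p1 p2 (delta D))
 (action p2 p2 (braid H H)) (action p2 p2 (braid_inv H H))
 _ _ _ _ _ _ _ _ _ _ _ _ _ _ _ _ _ _ _ _ _ _ _ _ _).
- intros; apply tensm_idl_comp.
- intros; apply tensm_id.
- intros X Y f. exact (action_nat p0 p1 (eta M) f).
- intros X Y f. exact (action_nat p2 p1 (mu M) f).
- intros X Y f. exact (action_nat p1 p0 (eps D) f).
- intros X Y f. exact (action_nat p1 p2 (delta D) f).
- intros X Y f. exact (action_nat p2 p2 (braid H H) f).
- intros X Y f. exact (action_nat p2 p2 (braid_inv H H) f).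
- intro X. exact_action H (mu_etal M) X.
- intro X. exact_action H (mu_etar M) X.
- intro X. exact_action H (delta_epsl D) X.
- intro X. exact_action H (delta_epsr D) X.
- intro X. exact_action H (delta_assoc D) X.
- intro X. exact_action H (proj1 (braidK H H)) X.
- intro X. exact_action H (proj2 (braidK H H)) X.
- intro X.
  act_on H (braid_tensr H H H) X hexagon.
  act_on H (braid_natural (idm H) (braid H H)) X natural.
  rewrite hexagon, <- comp_assoc in natural. exact natural.
- intro X.
  act_on H (braid_tensl H H H) X hexagon.
  act_on H (braid_natural (mu M) (idm H)) X natural.
  rewrite hexagon in natural. exact natural.
- intro X.
  act_on H (braid_tensr H H H) X hexagon.
  act_on H (braid_natural (idm H) (mu M)) X natural.
  rewrite hexagon in natural. exact natural.
- intro X.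
  pose proof (action_braid_unitl X) as trivial_braid. cbn [Nat.add] in trivial_braid.
  act_on H (braid_natural (eta M) (idm H)) X natural.
  rewrite trivial_braid, comp_idr in natural. exact natural.
- intro X.
  pose proof (action_braid_unitr X) as trivial_braid. cbn [Nat.add] in trivial_braid.
  act_on H (braid_natural (idm H) (eta M)) X natural.
  rewrite trivial_braid, comp_idr in natural. exact natural.
- intro X.
  act_on H (braid_tensl H H H) X hexagon.
  act_on H (braid_natural (delta D) (idm H)) X natural.
  rewrite hexagon, <- comp_assoc in natural. symmetry. exact natural.
- intro X.
  act_on H (braid_tensr H H H) X hexagon.
  act_on H (braid_natural (idm H) (delta D)) X natural.
  rewrite hexagon, <- comp_assoc in natural. symmetry. exact natural.
- intro X.
  pose proof (action_braid_unitr X) as trivial_braid. cbn [Nat.add] in trivial_braid.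
  act_on H (braid_natural (idm H) (eps D)) X natural.
  rewrite trivial_braid, comp_idl in natural. symmetry. exact natural.
- intro X. unfold cond_a1, delta_HH in ha1. exact_action H ha1 X.
- intro X. destruct ha2 as [E _]. exact_action H E X.
- intro X. destruct ha2 as (E1 & E2 & E3).
  exact_action H (eq_trans E1 (eq_trans E2 E3)) X.
- intro X. destruct ha3 as [E _]. exact_action H E X.
Defined.

Local Notation B := tens_bimonad.

Lemma action_PiL X : action p1 p1 (PiL M D) X = bm_PiL B X.
Proof.
assert (E : PiL M D ≡ PiL M D) by reflexivity.
unfold PiL at 2 in E. act_on H E X E'.
unfold bm_PiL. rewrite <- !comp_assoc. exact E'.
Qed.

Lemma action_PiR X : action p1 p1 (PiR M D) X = bm_PiR B X.
Proof.
assert (E : PiR M D ≡ PiR M D) by reflexivity.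
unfold PiR at 2 in E. act_on H E X E'.
unfold bm_PiR. rewrite !bm_map_comp, <- !comp_assoc. exact E'.
Qed.

Lemma action_galois X : action p2 p2 (galois_right M D) X = bm_galois B X.
Proof.
assert (E : galois_right M D ≡ galois_right M D) by reflexivity.
unfold galois_right at 2 in E. act_on H E X E'. exact E'.
Qed.

Lemma action_OmegaL X : action p2 p2 (Omega1 M D L) X = bm_Omega (bm_PiL B) X.
Proof.
assert (E : Omega1 M D L ≡ Omega1 M D L) by reflexivity.
unfold Omega1 at 2 in E. cbn [Pi] in E. act_on H E X E'.
rewrite action_PiL in E'. exact E'.
Qed.

Lemma action_OmegaR X : action p2 p2 (Omega1 M D R) X = bm_Omega (bm_PiR B) X.
Proof.
assert (E : Omega1 M D R ≡ Omega1 M D R) by reflexivity.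
unfold Omega1 at 2 in E. cbn [Pi] in E. act_on H E X E'.
rewrite action_PiR in E'. exact E'.
Qed.

Lemma mu_PiL_middle :
  mu M ∘ ((mu M ∘ (idm H ⊗ PiL M D)) ⊗ idm H)
  ≡ mu M ∘ (idm H ⊗ (mu M ∘ (PiL M D ⊗ idm H))).
Proof. by_action H. rewrite !action_PiL. exact (PiL_middle B X). Qed.

Lemma mu_PiL_left :
  mu M ∘ ((mu M ∘ (PiL M D ⊗ idm H)) ⊗ idm H) ≡ mu M ∘ (PiL M D ⊗ mu M).
Proof.
by_action H. rewrite !action_PiL.
etransitivity; [exact (PiL_left B X)|].
f_equal. symmetry. exact (PiL_nat B (bm_mult B X)).
Qed.

Lemma mu_PiL_conv_id : mu M ∘ (PiL M D ⊗ idm H) ∘ delta D ≡ idm H.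
Proof. by_action H. rewrite !action_PiL. exact (PiL_conv_id B X). Qed.

End Bimonad.

(** * The mirror image of a braided category *)

Definition mirror_monoidal (C : strict_monoidal_category) : strict_monoidal_category.
Proof.
refine (@StrictMonoidalCategory C unit_ob (fun A B => (B ⊗ A)%ob)
  (fun A B A' B' f g => g ⊗ f) _ _ _ _ _ _ _ _).
- intros; apply tensm_id.
- intros; apply tensm_comp.
- intros; symmetry; apply tens_assoc.
- intros; apply tens_unitr.
- intros; apply tens_unitl.
- intros; symmetry; apply tensm_assoc.
- intros; apply tensm_unitr.
- intros; apply tensm_unitl.
Defined.

(** The braiding of [A] with [B] is the original braiding of [B] with [A]; that of
    [H] with itself is unchanged, and [ΠL] and [ΠR] are exchanged. *)
Definition mirror (C : strict_braided_monoidal_category) : strict_braided_monoidal_category.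
Proof.
refine (@StrictBraidedMonoidalCategory (mirror_monoidal C)
  (fun A B => braid B A) (fun A B => braid_inv B A) _ _ _ _).
- intros; apply braidK.
- intros; apply braid_natural.
- intros. exact (eq_trans (braid_tensl D B A) (compose_arrow _ _ eq_refl eq_refl)).
- intros. exact (eq_trans (braid_tensr D B A) (compose_arrow _ _ eq_refl eq_refl)).
Defined.

Definition mirror_magma (C : strict_braided_monoidal_category) (H : C)
  (M : unital_magma H) : @unital_magma (mirror C) H :=
  @UnitalMagma (mirror C) H (eta M) (mu M) (mu_etal M) (mu_etar M).

Definition mirror_comonoid (C : strict_braided_monoidal_category) (H : C)
  (D : comonoid H) : @comonoid (mirror C) H :=
  @Comonoid (mirror C) H (eps D) (delta D) (delta_epsr D) (delta_epsl D)
    (eq_sym (delta_assoc D)).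

(* Writes diagrams of the mirror image as diagrams of the original category. *)
Ltac unmirror :=
  cbn [mirror mirror_monoidal mirror_magma mirror_comonoid braided_cat monoidal_cat
       unit_ob tens tensm braid braid_inv eta mu eps delta].
Ltac unmirror_in E :=
  cbn [mirror mirror_monoidal mirror_magma mirror_comonoid braided_cat monoidal_cat
       unit_ob tens tensm braid braid_inv eta mu eps delta] in E.

(** The axioms [a4_6] and [a4_7], in which the values of the antipode multiply
    from the right, with the two normalizations [a4_3l] and [a4_3r].  The mirror
    image of this notion consists of [a4_4], [a4_5] and the same
    normalizations. *)
Record right_antipode (C : strict_braided_monoidal_category) (H : C)
  (M : unital_magma H) (D : comonoid H) (lam : hom H H) : Prop := {
  right_conv_PiL : convolution M D lam (PiL M D) = lam;
  right_PiR_conv : convolution M D (PiR M D) lam = lam;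
  right_cancelL :
    mu M ∘ (mu M ⊗ lam) ∘ (idm H ⊗ delta D) = mu M ∘ (idm H ⊗ PiL M D);
  right_cancelR :
    mu M ∘ (mu M ⊗ idm H) ∘ (idm H ⊗ lam ⊗ idm H) ∘ (idm H ⊗ delta D)
    = mu M ∘ (idm H ⊗ PiR M D)
}.

Section Mirror.

Variables (C : strict_braided_monoidal_category) (H : C).
Variables (M : unital_magma H) (D : comonoid H).

Lemma mirror_a1 : cond_a1 M D -> cond_a1 (mirror_magma M) (mirror_comonoid D).
Proof.
intro h. unfold cond_a1, delta_HH in *. unmirror.
by_action H. exact_action H h X.
Qed.

Lemma mirror_a2 : cond_a2 M D -> cond_a2 (mirror_magma M) (mirror_comonoid D).
Proof.
intros (h1 & h2 & h3). unfold cond_a2. unmirror. repeat split.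
- symmetry. exact h1.
- by_action H. exact_action H (eq_trans h1 h2) X.
- by_action H. exact_action H h3 X.
Qed.

Lemma mirror_a3 : cond_a3 M D -> cond_a3 (mirror_magma M) (mirror_comonoid D).
Proof.
intros (h1 & h2). unfold cond_a3. unmirror. split.
- by_action H. act_on H h1 X E. act_on H (delta_assoc D) X E'.
  etransitivity; [|exact E]. now rewrite !comp_assoc, E'.
- by_action H. exact_action H h2 X.
Qed.

Lemma mirror_PiL : PiL (mirror_magma M) (mirror_comonoid D) = PiR M D.
Proof. unfold PiL, PiR. unmirror. by_action H. reflexivity. Qed.

Lemma mirror_PiR : PiR (mirror_magma M) (mirror_comonoid D) = PiL M D.
Proof. unfold PiL, PiR. unmirror. by_action H. reflexivity. Qed.

Lemma mirror_OmegaL : Omega1 (mirror_magma M) (mirror_comonoid D) L = Omega2 M D R.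
Proof.
unfold Omega1, Omega2, Pi. rewrite mirror_PiL. unmirror. by_action H. reflexivity.
Qed.

Lemma mirror_OmegaR : Omega1 (mirror_magma M) (mirror_comonoid D) R = Omega2 M D L.
Proof.
unfold Omega1, Omega2, Pi. rewrite mirror_PiR. unmirror. by_action H. reflexivity.
Qed.

Lemma mirror_galois :
  galois_right (mirror_magma M) (mirror_comonoid D) = galois_left M D.
Proof. unfold galois_left, galois_right. unmirror. by_action H. reflexivity. Qed.

Lemma mirror_convolution (u v : hom H H) :
  convolution (mirror_magma M) (mirror_comonoid D) u v = convolution M D v u.
Proof. unfold convolution. unmirror. by_action H. reflexivity. Qed.

Lemma mirror_almost_left_linear phi :
  almost_left_linear (mirror_magma M) phi <-> almost_right_linear M phi.
Proof.
unfold almost_left_linear, almost_right_linear. unmirror.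
split; intro h; by_action H; exact_action H h X.
Qed.

Lemma mirror_right_antipode (lam : hom H H) :
  right_antipode (mirror_magma M) (mirror_comonoid D) lam <->
  (convolution M D (PiR M D) lam = lam /\ convolution M D lam (PiL M D) = lam /\
   mu M ∘ (lam ⊗ mu M) ∘ (delta D ⊗ idm H) = mu M ∘ (PiR M D ⊗ idm H) /\
   mu M ∘ (idm H ⊗ mu M) ∘ (idm H ⊗ lam ⊗ idm H) ∘ (delta D ⊗ idm H)
   = mu M ∘ (PiL M D ⊗ idm H)).
Proof.
split.
- intros [h1 h2 h3 h4].
  rewrite mirror_convolution, mirror_PiL in h1.
  rewrite mirror_convolution, mirror_PiR in h2.
  rewrite mirror_PiL in h3. rewrite mirror_PiR in h4.
  unmirror_in h3. unmirror_in h4.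
  repeat (split; trivial); by_action H; [exact_action H h3 X|exact_action H h4 X].
- intros (h1 & h2 & h3 & h4).
  constructor; rewrite ?mirror_convolution, ?mirror_PiL, ?mirror_PiR; trivial;
    unmirror; by_action H; [exact_action H h3 X|exact_action H h4 X].
Qed.

End Mirror.

(** * The right Galois morphism and antipodes *)

(** For [b] with [b e1 = b = e2 b] and idempotents [e1], [e2], the inverse of the
    restriction of [b] to the images of the idempotents, as an endomorphism of
    the whole object. *)
Record relative_inverse (A : category) (X : A) (b e1 e2 phi : hom X X) : Prop := {
  rel_left : phi ∙ b = e1;
  rel_right : b ∙ phi = e2;
  rel_absorb2 : phi ∙ e2 = phi;
  rel_absorb1 : e1 ∙ phi = phi
}.

Section OneSided.

Variables (C : strict_braided_monoidal_category) (H : C).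
Variables (M : unital_magma H) (D : comonoid H).
Hypotheses (ha1 : cond_a1 M D) (ha2 : cond_a2 M D) (ha3 : cond_a3 M D).

Local Notation B := (tens_bimonad ha1 ha2 ha3).
Local Notation p1 := (is_power_one H).
Local Notation p2 := (is_power_tens (is_power_one H) (is_power_one H)).

Let actPiL := action_PiL ha1 ha2 ha3.
Let actPiR := action_PiR ha1 ha2 ha3.
Let actG := action_galois ha1 ha2 ha3.
Let actOmL := action_OmegaL ha1 ha2 ha3.
Let actOmR := action_OmegaR ha1 ha2 ha3.

Let m1 := mirror_a1 ha1.
Let m2 := mirror_a2 ha2.
Let m3 := mirror_a3 ha3.

(** [ΠR] is the morphism [ΠL] of the mirror image; the next three lemmas are
    its properties there, with all products reversed. *)
Lemma PiR_middle X :
  bm_mult B X ∙ bm_mult B _ ∙ bm_map B (bm_PiR B _)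
  = bm_mult B X ∙ bm_map B (bm_mult B X) ∙ bm_map B (bm_PiR B _).
Proof.
pose proof (mu_PiL_middle m1 m2 m3) as h. unmirror_in h. rewrite mirror_PiL in h.
act_on H h X E. rewrite !actPiR in E. symmetry. exact E.
Qed.

Lemma PiR_right X :
  bm_mult B X ∙ bm_mult B _ ∙ bm_map B (bm_map B (bm_PiR B X))
  = bm_mult B X ∙ bm_map B (bm_mult B X) ∙ bm_map B (bm_map B (bm_PiR B X)).
Proof.
pose proof (mu_PiL_left m1 m2 m3) as h. unmirror_in h. rewrite mirror_PiL in h.
act_on H h X E. rewrite !actPiR in E. symmetry. exact E.
Qed.

Lemma id_conv_PiR X : bm_mult B X ∙ bm_map B (bm_PiR B X) ∙ bm_comult B X = idm _.
Proof.
pose proof (mu_PiL_conv_id m1 m2 m3) as h. unmirror_in h. rewrite mirror_PiL in h.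
act_on H h X E. rewrite !actPiR in E. exact E.
Qed.

Lemma galois_right_OmegaL : galois_right M D ∙ Omega1 M D L = galois_right M D.
Proof. by_action H. rewrite actG, actOmL. exact (galois_OmegaL B X). Qed.

Lemma OmegaR_galois_right : Omega1 M D R ∙ galois_right M D = galois_right M D.
Proof.
by_action H. rewrite actG, actOmR. exact (OmegaR_galois PiR_right id_conv_PiR X).
Qed.

Lemma right_antipode_action lam :
  right_antipode M D lam <-> bm_antipode (B := B) (action p1 p1 lam).
Proof.
split.
- intros [h1 h2 h3 h4]. unfold convolution in h1, h2. constructor.
  + intros X Y f. exact (action_nat p1 p1 lam f).
  + intro X. act_on H h1 X E. rewrite actPiL in E. exact E.
  + intro X. act_on H h2 X E. rewrite actPiR in E. exact E.
  + intro X. act_on H h3 X E. rewrite actPiL in E. exact E.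
  + intro X. act_on H h4 X E. rewrite actPiR in E. exact E.
- intros [_ h1 h2 h3 h4]. constructor; unfold convolution; by_action H.
  + rewrite actPiL. exact (h1 X).
  + rewrite actPiR. exact (h2 X).
  + rewrite actPiL. exact (h3 X).
  + rewrite actPiR. exact (h4 X).
Qed.

Lemma right_antipode_conv lam : right_antipode M D lam ->
  convolution M D (idm H) lam = PiL M D /\ convolution M D lam (idm H) = PiR M D.
Proof.
intro hl. pose proof (antipode_conv (proj1 (right_antipode_action lam) hl)) as h.
unfold convolution; split; by_action H.
- rewrite actPiL. exact (proj1 (h X)).
- rewrite actPiR. exact (proj2 (h X)).
Qed.

Lemma right_antipode_unique lam lam' : right_antipode M D lam ->
  convolution M D lam' (idm H) = PiR M D -> convolution M D lam' (PiL M D) = lam' ->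
  lam = lam'.
Proof.
intros hl h1 h2. by_action H. unfold convolution in *.
apply (antipode_unique (B := B) (lam' := action p1 p1 lam')).
- now apply right_antipode_action.
- intros; apply (action_nat p1 p1).
- intro Y. act_on H h1 Y E. rewrite actPiR in E. exact E.
- act_on H h2 X E. rewrite actPiL in E. exact E.
Qed.

Definition antipode_of (phi : hom (H ⊗ H)%ob (H ⊗ H)%ob) : hom H H :=
  ⟨ (idm H ⊗ eps D) ∘ phi ∘ (eta M ⊗ idm H) ⟩.

Lemma action_antipode_of phi X : action p1 p1 (antipode_of phi) X =
  bm_map B (bm_counit B X) ∙ action p2 p2 phi X ∙ bm_unit B _.
Proof.
assert (E : antipode_of phi ≡ antipode_of phi) by reflexivity.
unfold antipode_of at 2 in E. act_on H E X E'. exact E'.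
Qed.

(** The inverse of the right Galois morphism and a right antipode determine each
    other, by the formulas [φ (x ⊗ h) = x λ(h₁) ⊗ h₂] and
    [λ(h) = (id ⊗ ε) φ (1 ⊗ h)]. *)
Lemma right_antipode_iff_galois :
  (exists lam, right_antipode M D lam) <->
  (exists phi,
     relative_inverse (galois_right M D) (Omega1 M D L) (Omega1 M D R) phi /\
     almost_left_linear M phi).
Proof.
split.
- intros [lam hl].
  destruct (antipode_galois_inverse PiR_middle (proj1 (right_antipode_action lam) hl))
    as [_ h1 h2 h3 h4 h5].
  exists ((mu M ⊗ idm H) ∘ (idm H ⊗ lam ⊗ idm H) ∘ (idm H ⊗ delta D)).
  split; [constructor|unfold almost_left_linear]; by_action H.
  + rewrite actG, actOmL, <- h1. unfold bm_Omega. now rewrite <- !comp_assoc.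
  + rewrite actG, actOmR, <- h2. now unfold bm_Omega.
  + rewrite actOmR. etransitivity; [|exact (h3 X)].
    unfold bm_Omega. now rewrite <- !comp_assoc.
  + rewrite actOmL. exact (h4 X).
  + etransitivity; [exact (h5 X)|].
    unfold bm_Omega. now rewrite !bm_map_comp, <- !comp_assoc.
- intros (phi & [h1 h2 h3 h4] & h5). unfold almost_left_linear in h5.
  exists (antipode_of phi). apply right_antipode_action.
  refine (bm_antipode_ext _ (galois_inverse_antipode (B := B) (phi := action p2 p2 phi) _)).
  { exact (action_antipode_of phi). }
  constructor.
  + intros X Y f. exact (action_nat p2 p2 phi f).
  + intro X. act_on H h1 X E. rewrite actG, actOmL in E. exact E.
  + intro X. act_on H h2 X E. rewrite actG, actOmR in E. exact E.
  + intro X. act_on H h3 X E. rewrite actOmR in E. exact E.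
  + intro X. act_on H h4 X E. rewrite actOmL in E. exact E.
  + intro X. exact_action H h5 X.
Qed.

End OneSided.

(** * Isomorphisms between split idempotents *)

Section Splitting.

Variables (A : category) (X : A) (b e1 e2 : hom X X).
Variables (S1 : splitting e1) (S2 : splitting e2).
Hypotheses (be1 : b ∙ e1 = b) (e2b : e2 ∙ b = b).

Lemma inverse_relative_inverse f' :
  inverse_morphisms ((split_q S2 ∙ b) ∙ split_j S1) f' ->
  relative_inverse b e1 e2 ((split_j S1 ∙ f') ∙ split_q S2).
Proof.
destruct S1 as [Y1 q1 j1 jq1 qj1], S2 as [Y2 q2 j2 jq2 qj2]; simpl in *.
subst e1 e2. intros [h1 h2].
constructor; rewrite <- !comp_assoc in *.
- transitivity (j1 ∙ f' ∙ q2 ∙ b ∙ j1 ∙ q1).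
  + now rewrite be1.
  + rewrite (comp_assoc b), (comp_assoc q2), (comp_assoc f'), h1.
    apply f_equal, comp_idl.
- transitivity (j2 ∙ q2 ∙ b ∙ j1 ∙ f' ∙ q2).
  + now rewrite (comp_assoc q2 b), (comp_assoc j2 (q2 ∙ b)), e2b.
  + rewrite (comp_assoc j1), (comp_assoc b), (comp_assoc q2), h2.
    apply f_equal, comp_idl.
- now rewrite (comp_assoc q2), qj2, comp_idl.
- now rewrite (comp_assoc q1), qj1, comp_idl.
Qed.

(** [φ ↦ q1 φ j2] and [f' ↦ j1 f' q2] are inverse to each other. *)
Lemma relative_inverse_inverse phi : relative_inverse b e1 e2 phi ->
  inverse_morphisms ((split_q S2 ∙ b) ∙ split_j S1) (split_q S1 ∙ phi ∙ split_j S2)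
  /\ (split_j S1 ∙ (split_q S1 ∙ phi ∙ split_j S2)) ∙ split_q S2 = phi.
Proof.
destruct S1 as [Y1 q1 j1 jq1 qj1], S2 as [Y2 q2 j2 jq2 qj2]; simpl in *.
intros [h1 h2 h3 h4]. repeat split.
- transitivity (q1 ∙ (phi ∙ ((j2 ∙ q2) ∙ b)) ∙ j1); [now rewrite <- !comp_assoc|].
  now rewrite jq2, e2b, h1, <- jq1, <- !comp_assoc, qj1, comp_idr.
- transitivity (q2 ∙ (b ∙ ((j1 ∙ q1) ∙ phi)) ∙ j2); [now rewrite <- !comp_assoc|].
  now rewrite jq1, h4, h2, <- jq2, <- !comp_assoc, qj2, comp_idr.
- transitivity ((j1 ∙ q1) ∙ (phi ∙ (j2 ∙ q2))); [now rewrite <- !comp_assoc|].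
  now rewrite jq1, jq2, h3.
Qed.

End Splitting.

(** * The characterization *)

Theorem theorem2p10 (C : strict_braided_monoidal_category)
  (hasEq : has_equalizers C) (hasCoeq : has_coequalizers C)
  (H : C) (M : unital_magma H) (D : comonoid H)
  (ha1 : cond_a1 M D) (ha2 : cond_a2 M D) (ha3 : cond_a3 M D)
  (SL1 : splitting (Omega1 M D L)) (SR1 : splitting (Omega1 M D R))
  (SL2 : splitting (Omega2 M D L)) (SR2 : splitting (Omega2 M D R)) :
  let f := split_q SR1 ∘ galois_right M D ∘ split_j SL1 in
  let g := split_q SL2 ∘ galois_left M D ∘ split_j SR2 in
  weak_hopf_quasigroup M D <->
  exists (f' : hom (split_ob SR1) (split_ob SL1))
         (g' : hom (split_ob SL2) (split_ob SR2)),
    inverse_morphisms f f' /\ inverse_morphisms g g' /\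
    almost_left_linear M (split_j SL1 ∘ f' ∘ split_q SR1) /\
    almost_right_linear M (split_j SR2 ∘ g' ∘ split_q SL2).
Proof.
intros f g.
set (m1 := mirror_a1 ha1). set (m2 := mirror_a2 ha2). set (m3 := mirror_a3 ha3).
pose proof (galois_right_OmegaL ha1 ha2 ha3) as bL.
pose proof (OmegaR_galois_right ha1 ha2 ha3) as bR.
pose proof (galois_right_OmegaL m1 m2 m3) as gL.
pose proof (OmegaR_galois_right m1 m2 m3) as gR.
pose proof (right_antipode_iff_galois ha1 ha2 ha3) as iff_right.
pose proof (right_antipode_iff_galois m1 m2 m3) as iff_left.
rewrite mirror_OmegaL, mirror_galois in gL.
rewrite mirror_OmegaR, mirror_galois in gR.
rewrite mirror_OmegaL, mirror_OmegaR, mirror_galois in iff_left.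
split.
- intros (_ & _ & _ & lam & [h1 h2 h3 h4 h5 h6 h7 h8]).
  destruct (proj1 iff_right) as (phi & phi_inv & phi_lin).
  { exists lam. now constructor. }
  destruct (proj1 iff_left) as (psi & psi_inv & psi_lin).
  { exists lam. now apply mirror_right_antipode. }
  apply mirror_almost_left_linear in psi_lin.
  destruct (relative_inverse_inverse (A := C) SL1 SR1 bR phi_inv) as (f_inv & phi_eq).
  destruct (relative_inverse_inverse (A := C) SR2 SL2 gR psi_inv) as (g_inv & psi_eq).
  exists (split_q SL1 ∙ phi ∙ split_j SR1), (split_q SR2 ∙ psi ∙ split_j SL2).
  exact (conj f_inv (conj g_inv (conj
    (eq_ind_r (almost_left_linear M) phi_lin phi_eq)
    (eq_ind_r (almost_right_linear M) psi_lin psi_eq)))).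
- intros (f' & g' & f_inv & g_inv & f_lin & g_lin).
  destruct (proj2 iff_right) as (lam & hl).
  { exists ((split_j SL1 ∙ f') ∙ split_q SR1). split; [|exact f_lin].
    exact (inverse_relative_inverse bL bR f_inv). }
  destruct (proj2 iff_left) as (lam' & hl').
  { exists ((split_j SR2 ∙ g') ∙ split_q SL2).
    split; [|now apply mirror_almost_left_linear].
    exact (inverse_relative_inverse gL gR g_inv). }
  destruct (right_antipode_conv m1 m2 m3 hl') as [conv_id _].
  rewrite mirror_convolution, mirror_PiL in conv_id.
  apply mirror_right_antipode in hl'. destruct hl' as (_ & conv_PiL & cancelR & cancelL).
  rewrite <- (right_antipode_unique ha1 ha2 ha3 hl conv_id conv_PiL) in cancelL, cancelR.
  destruct (right_antipode_conv ha1 ha2 ha3 hl), hl.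
  repeat (split; trivial). exists lam. now constructor.
Qed.
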